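(* Let $\epsilon,\delta$ be nonnegative real numbers with $\epsilon<\frac{1}{132}$ and $\delta<\frac{(1-132\epsilon)^2}{83272}$. Let $G$ be a finite simple tripartite graph with tripartition $(V_1,V_2,V_3)$ such that (i) $|V_1|=|V_2|=|V_3|=n$; (ii) for every $i\in\{1,2,3\}$ and every vertex $v\in V_i$, $\deg_+(v)=\deg_-(v)\ge(1-\epsilon)n$; (iii) $|E(G)|>(1-\delta)\cdot 3n^2$. Then $G$ admits a triangle decomposition.
   Context: For a tripartite graph with parts $V_1,V_2,V_3$ (indices taken modulo $3$) and $v\in V_i$, $\deg_+(v)$ denotes the number of neighbors of $v$ in $V_{i+1}$ and $\deg_-(v)$ the number of neighbors of $v$ in $V_{i-1}$. A triangle decomposition of $G$ is a collection of subgraphs of $G$, each a triangle (copy of $K_3$), whose edge sets partition $E(G)$. *)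

(* Defs.v *)
From HB Require Import structures.
From mathcomp Require Import all_boot all_order all_algebra.
From mathcomp Require Import reals.

Set Implicit Arguments.
Unset Strict Implicit.
Unset Printing Implicit Defensive.

Import GRing.Theory.
Local Open Scope ring_scope.

Section TripartiteGraphs.
Variables (T : finType) (e : rel T).

Definition simple_graph : Prop := symmetric e /\ irreflexive e.

Definition edges : {set {set T}} :=
  [set A | [exists x, exists y, e x y && (A == [set x; y])]].

(* The index type 'Z_3 is {0, 1, 2} with cyclic arithmetic, so that i + 1 and
   i - 1 are taken modulo 3.  Parts are allowed to be empty. *)
Definition tripartition (V : 'Z_3 -> {set T}) : Prop :=
  (forall x : T, exists! i, x \in V i) /\
  (forall i x y, x \in V i -> y \in V i -> ~~ e x y).

(* Meaningful for v \in V i. *)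
Definition deg_plus (V : 'Z_3 -> {set T}) (i : 'Z_3) (v : T) : nat :=
  #|[set w in V (i + 1) | e v w]|.

Definition deg_minus (V : 'Z_3 -> {set T}) (i : 'Z_3) (v : T) : nat :=
  #|[set w in V (i - 1) | e v w]|.

(* A triangle, i.e. a subgraph isomorphic to K_3, is encoded by its vertex set:
   being complete, it is determined by it, and its edges are all of the
   two-element subsets. *)
Definition is_triangle (A : {set T}) : bool :=
  (#|A| == 3) && [forall x in A, forall y in A, (x != y) ==> e x y].

Definition triangle_edges (A : {set T}) : {set {set T}} :=
  [set B : {set T} | (B \subset A) && (#|B| == 2)].

(* triangle_edges is injective on three-element sets, so passing to the set of
   edge sets identifies no two members of D. *)
Definition triangle_decomposition (D : {set {set T}}) : Prop :=
  (forall A, A \in D -> is_triangle A) /\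
  partition [set triangle_edges A | A in D] edges.

End TripartiteGraphs.

(* Main.v *)
(* A Latin square in which almost every triple of vertices lies in a flippable
   octahedron (eight triangles on two vertices of each part, four of them in the
   square) is corrected locally until it avoids the missing edges.  The missing
   edges split into closed walks through the three parts; with an auxiliary
   vertex [hub] of the second part, each walk is written as a sum of triangles
   to subtract minus triangles to add, alternately, so that at every moment all
   but a few edges are covered exactly once.  A triangle is subtracted by at
   most 45 removals and some additions of triangles: the partners of its edges
   in the current decomposition are exchanged until only signed 4-cycles on
   freely chosen vertices are left, and each of these is realised by flipping
   two octahedra through a common vertex.  The flipped triangles must still
   belong to the original square, so vertices that have lost many of them are
   avoided; the bound on delta makes such vertices rare, and the bound on
   epsilon leaves room for the choices. *)
Require Import Defs.
From HB Require Import structures.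
From mathcomp Require Import all_boot all_order all_algebra.
From mathcomp Require Import reals.
From mathcomp Require Import ring lra zify.

Set Implicit Arguments.
Unset Strict Implicit.
Unset Printing Implicit Defensive.

Import Order.TTheory GRing.Theory Num.Theory.
Local Open Scope ring_scope.

(** * Counting *)

Section Counting.
Local Open Scope nat_scope.

(** An octahedron is flipped only while its four triangles from the original square are present, so
    the cost of a correction is the number of square triangles that it loses. With [M] missing edges
    between any two parts, each of the 2M missing edges at the first part costs one subtraction, so
    at most 90M triangles are lost. By averaging, fewer than (B+1)(t+1) losses leave at most [B]
    vertices of each part with more than [t] losses; B = 4t makes t^2 of order 45M/2 sufficient,
    while the free choices need n to exceed a multiple of t. Hence a bound on [M] quadratic in n -
    132d. A family of triangles is a list tested on edge weights, not a set: edges may be covered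
    twice for a while, and adding a triangle costs nothing. The square itself has order 4m with m
    odd; the at most seven further vertices are adjoined afterwards and are never chosen freely. *)

Lemma exists_avoiding (X : finType) (S : {set X}) (Bs : seq {set X}) :
  \sum_(B <- Bs) #|B| < #|S| -> exists2 x, x \in S & all (fun B : {set X} => x \notin B) Bs.
Proof.
elim: Bs S => [|B Bs IH] S.
  by rewrite big_nil card_gt0 => /set0Pn[x xS]; exists x.
rewrite big_cons => ltS.
have /IH[x] : \sum_(B <- Bs) #|B| < #|S :\: B|.
  by have := cardsID B S; have := subset_leq_card (subsetIr S B); lia.
by rewrite inE => /andP[xB xS] xBs; exists x => //=; rewrite xB.
Qed.

Lemma card_inj_sub (X Y : finType) (f : X -> Y) (A : {set X}) (B : {set Y}) :
  injective f -> (forall x, x \in A -> f x \in B) -> #|A| <= #|B|.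
Proof.
move=> f_inj fAB; rewrite -(card_imset _ f_inj).
by apply/subset_leq_card/subsetP => _ /imsetP[x xA ->]; apply: fAB.
Qed.

Lemma card_mem_seq (X : finType) (s : seq X) : #|[set x in s]| <= size s.
Proof. by rewrite cardsE; apply: card_size. Qed.

Lemma card_setUle (X : finType) (A B : {set X}) : #|A :|: B| <= #|A| + #|B|.
Proof. by rewrite cardsU leq_subr. Qed.

(** Models the triangles of [L] through one vertex, seen as pairs of vertices of the other two
    parts. Omitted edges at that vertex leave at most [d] vertices without partner; edges covered
    more than once contribute the excess [q]. *)
Definition near_matching (U V : finType) (E : U -> V -> bool) (d q : nat) :=
  #|[set u | ~~ [exists v, E u v]]| <= d /\
  \sum_v (#|[set u | E u v]| .-1) <= q.

(** A forbidden [v] spoils one [u], together with the excess of its fibre, and all the excesses add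
    up to at most [q]. *)
Lemma near_matching_avoid (U V : finType) (E : U -> V -> bool) d q
    (Q : {set V}) : near_matching E d q ->
  #|[set u | ~~ [exists v, E u v && (v \notin Q)]]| <= d + q + #|Q|.
Proof.
move=> [Ed Eq].
set A := [set u | _]; set Z := [set u | ~~ [exists v, E u v]] in Ed.
have sub : A \subset Z :|: \bigcup_(v in Q) [set u | E u v].
  apply/subsetP=> u; rewrite !inE; case: (boolP [exists v, E u v]) => //=.
  case/existsP=> v Euv /existsPn/(_ v); rewrite Euv /= negbK => vQ.
  by apply/bigcupP; exists v; rewrite ?inE.
have cardU : #|\bigcup_(v in Q) [set u | E u v]| <= q + #|Q|.
  apply: leq_trans (_ : \sum_(v in Q) #|[set u | E u v]| <= _).
    elim/big_ind2: _ => //= [|x A1 y A2 h1 h2]; first by rewrite cards0.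
    by apply: leq_trans (card_setUle _ _) (leq_add h1 h2).
  apply: leq_trans (_ : \sum_(v in Q) (#|[set u | E u v]| .-1 + 1) <= _).
    by apply: leq_sum => v _; lia.
  rewrite big_split /= sum1_card leq_add2r; apply: leq_trans Eq.
  by rewrite [leqRHS](bigID (mem Q)) /= leq_addr.
by have := subset_leq_card sub; have := card_setUle Z (\bigcup_(v in Q) [set u | E u v]); lia.
Qed.

(** Removes named entries from a list that may contain repetitions. The entries must be pairwise
    distinct, which is why every batch of removed triangles is shown to be [uniq]. *)
Lemma perm_cat_uniq (T : eqType) (A L : seq T) :
  uniq A -> {subset A <= L} -> exists L', perm_eq L (A ++ L').
Proof.
elim: A L => [|x A IH] L /=; first by exists L.
case/andP=> xA uA sub.
have xL : x \in L by apply: sub; rewrite inE eqxx.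
have [|L' pL'] := IH (rem x L) uA.
  move=> y yA; have : y \in L by apply: sub; rewrite inE yA orbT.
  rewrite (perm_mem (perm_to_rem xL)) inE => /orP[/eqP yx|//].
  by rewrite -yx yA in xA.
by exists L'; apply: perm_trans (perm_to_rem xL) _; rewrite perm_cons.
Qed.

End Counting.

(* The triples [mk x y z] are triangles seen from one of the three parts, so
   that the argument applies to all of them by rotation. *)
Section Cycle.
Variables (W G : finType) (emb : G -> W).
Hypothesis emb_inj : injective emb.
Variable (T : eqType) (mk : W -> W -> W -> T) (p1 p2 : T -> W).
Hypothesis p1K : forall x y z, p1 (mk x y z) = x.
Hypothesis mk_inj : forall x y z x' y' z', mk x y z = mk x' y' z' -> [/\ x = x', y = y' & z = z'].
Hypothesis p2K : forall x y z, p2 (mk x y z) = y.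
Variables (f1 f2 f3 : G -> G -> G) (off : G -> G -> G -> bool) (h tau : nat).
Hypothesis f13 : forall x y, f1 y (f3 x y) = x.
Hypothesis f31 : forall y z, f3 (f1 y z) y = z.
Hypothesis f32 : forall z x, f3 x (f2 z x) = z.
Hypothesis f12 : forall z x, f1 (f2 z x) z = x.
Hypothesis off_on : forall x y, off x y (f3 x y) = false.
Hypothesis octahedron : forall x y z, off x y z -> f3 (f1 y z) (f2 z x) = f3 x y.
Hypothesis off_card : forall v w v' w', (h <= #|[set x | off x v w && off x v' w']|)%N.

Variable L : seq T.
(** A vertex is good when at most [tau] of the square's triangles through it are absent from [L].
    The three versions differ in the part of [g], hence in the coordinate that enumerates these
    triangles. *)
Definition good1st g := (#|[set y | mk (emb g) (emb y) (emb (f3 g y)) \notin L]| <= tau)%N.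
Definition good2nd g := (#|[set z | mk (emb (f1 g z)) (emb g) (emb z) \notin L]| <= tau)%N.
Definition good3rd g := (#|[set x | mk (emb x) (emb (f2 g x)) (emb g) \notin L]| <= tau)%N.

(* The signed 4-cycle [v'w + vw' - vw - v'w'] is realised by a hub [x]: the
   triangles [xvw] and [xv'w'] are subtracted by flipping the octahedra that
   contain them.  The two triangles of [L] on [vw] and [v'w'] needed for these
   flips are removed by the caller. *)
Lemma four_cycle (Rm Lc : seq T) (v v' w w' : G) :
  perm_eq L (Rm ++ Lc) -> v != v' -> w != w' ->
  good2nd v -> good2nd v' -> good3rd w -> good3rd w' ->
  good1st (f1 v w) -> good1st (f1 v' w') ->
  (6 * tau + 3 * size Rm + 2 < h)%N ->
  exists Rm' Lc' Ad, [/\ perm_eq Lc (Rm' ++ Lc'), size Rm' = 6 &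
    forall (wt : T -> int) (A B C : W -> W -> int),
      (forall x y z, wt (mk x y z) = A x y + B y z + C z x) ->
      \sum_(t <- Ad) wt t = \sum_(t <- Rm') wt t
        + wt (mk (emb (f1 v w)) (emb v) (emb w))
        + wt (mk (emb (f1 v' w')) (emb v') (emb w'))
        + (B (emb v) (emb w') + B (emb v') (emb w)
           - B (emb v) (emb w) - B (emb v') (emb w'))].
Proof.
move=> pL vv' ww' gv gv' gw gw' gx gx' hlt.
pose x0 := f1 v w; pose x0' := f1 v' w'.
pose S := [set x | off x v w && off x v' w'].
pose b1 v := [set x | mk (emb x) (emb v) (emb (f3 x v)) \notin L].
pose b2 w := [set x | mk (emb x) (emb (f2 w x)) (emb w) \notin L].
pose b3 x0 w := [set x | mk (emb x0) (emb (f2 w x)) (emb (f3 x0 (f2 w x))) \notin L].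
pose rm1 := [set x | emb x \in map p1 Rm].
pose rm3 w := [set x | emb (f2 w x) \in map p2 Rm].
have b1P u : good2nd u -> (#|b1 u| <= tau)%N.
  apply: leq_trans; apply: (@card_inj_sub _ _ (fun x => f3 x u)).
    by move=> x y e; rewrite -[x](f13 x u) e f13.
  by move=> x; rewrite !inE f13.
have b2P u : good3rd u -> (#|b2 u| <= tau)%N by [].
have b3P u u0 : good1st u0 -> (#|b3 u0 u| <= tau)%N.
  apply: leq_trans; apply: (@card_inj_sub _ _ (fun x => f2 u x)).
    by move=> x y e; rewrite -[x](f12 u x) e f12.
  by move=> x; rewrite !inE.
have rm1P : (#|rm1| <= size Rm)%N.
  rewrite -(size_map p1); apply: leq_trans (card_mem_seq _).
  by apply: (card_inj_sub emb_inj) => x; rewrite !inE.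
have rm3P u : (#|rm3 u| <= size Rm)%N.
  rewrite -(size_map p2); apply: leq_trans (card_mem_seq _).
  apply: (@card_inj_sub _ _ (fun x => emb (f2 u x))) => [x y /emb_inj e|x].
    by rewrite -[x](f12 u x) e f12.
  by rewrite !inE.
(* Six sets keep the triangles to be removed in [L]. Three keep them out of [Rm]: [t3] and [t3'] do
   not contain [x], so they are recognised by their second vertex. The two singletons separate [t1]
   from [t2'] and [t1'] from [t2]. *)
have [|x] := @exists_avoiding _ S [:: b1 v; b2 w; b3 x0 w; b1 v'; b2 w'; b3 x0' w';
   rm1; rm3 w; rm3 w'; [set f1 v w']; [set f1 v' w]].
  rewrite !big_cons big_nil !cards1.
  have := b1P v gv; have := b1P v' gv'; have := b2P w gw; have := b2P w' gw'.
  have := b3P w x0 gx; have := b3P w' x0' gx'; have := rm3P w; have := rm3P w'.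
  by have := off_card v w v' w'; rewrite -/S; lia.
rewrite inE => /andP[o o'] /=.
rewrite !andbT => /and5P[a1 a2 a3 a1' /and5P[a2' a3' r1 r3 /and3P[r3' e1 e2]]].
move: a1 a2 a3 a1' a2' a3' e1 e2; rewrite !inE !negbK => a1 a2 a3 a1' a2' a3' e1 e2.
have r1P t : t \in Rm -> p1 t != emb x.
  by move=> tRm; apply: contraNneq r1 => e; rewrite inE -e map_f.
have r3P u t : x \notin rm3 u -> t \in Rm -> p2 t != emb (f2 u x).
  by move=> xu tRm; apply: contraNneq xu => e; rewrite inE -e map_f.
have oc : f3 x0 (f2 w x) = f3 x v := octahedron o.
have oc' : f3 x0' (f2 w' x) = f3 x v' := octahedron o'.
rewrite oc in a3; rewrite oc' in a3'.
set t1 := mk _ _ _ in a1; set t2 := mk _ _ _ in a2; set t3 := mk _ _ _ in a3.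
set t1' := mk _ _ _ in a1'; set t2' := mk _ _ _ in a2'; set t3' := mk _ _ _ in a3'.
have xx0 : x != x0.
  by apply: contraTneq o => ->; rewrite /x0 -[w in off _ _ w](f31 v w) off_on.
have xx0' : x != x0'.
  by apply: contraTneq o' => ->; rewrite /x0' -[w' in off _ _ w'](f31 v' w') off_on.
have vv1 : v != f2 w x.
  by apply: contraNneq xx0 => e; rewrite /x0 e f12.
have vv1' : v' != f2 w' x.
  by apply: contraNneq xx0' => e; rewrite /x0' e f12.
have v1v1' : f2 w x != f2 w' x.
  by apply: contraNneq ww' => e; rewrite -[w](f32 w x) e f32.
have vv1x : v != f2 w' x.
  by apply: contraNneq e1 => ->; rewrite f12.
have vv1x' : v' != f2 w x.
  by apply: contraNneq e2 => ->; rewrite f12.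
(* In each octahedron these three triangles and the one left to the caller are the four in the
   square. Adding the opposite four except the one on [x] amounts to subtracting the latter. *)
pose Rm' := [:: t1; t2; t3; t1'; t2'; t3'].
have neq (y z y' z' : G) (u u' : G) : (u != u') || (y != y') ->
    mk (emb u) (emb y) (emb z) != mk (emb u') (emb y') (emb z').
  by apply: contraTneq => /mk_inj[/emb_inj-> /emb_inj-> _]; rewrite !eqxx.
have uRm : uniq Rm'.
  rewrite /= !inE !negb_or !andbT.
  by rewrite !neq // ?xx0 ?xx0' ?vv' ?vv1 ?vv1' ?v1v1' ?vv1x ?vv1x' ?orbT // eq_sym ?xx0 ?xx0' ?vv1x' ?orbT.
have sub : {subset Rm' <= Lc}.
  have in_Lc t : t \in L -> t \notin Rm -> t \in Lc.
    by rewrite (perm_mem pL) mem_cat => /orP[->|].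
  have nr1 y z : mk (emb x) (emb y) z \notin Rm.
    by apply/negP => /r1P; rewrite p1K eqxx.
  have nr3 u y z : x \notin rm3 u -> mk y (emb (f2 u x)) z \notin Rm.
    by move=> xu; apply/negP => /(r3P _ _ xu); rewrite p2K eqxx.
  move=> t; rewrite !inE => /orP[|/orP[|/orP[|/orP[|/orP[|]]]]] /eqP->; apply: in_Lc => //;
    by [apply: nr1 | apply: nr3].
have [Lc' pLc'] := perm_cat_uniq uRm sub.
exists Rm', Lc', [:: mk (emb x) (emb v) (emb w'); mk (emb x) (emb v') (emb w);
  mk (emb x) (emb (f2 w x)) (emb (f3 x v)); mk (emb x0) (emb v) (emb (f3 x v));
  mk (emb x0) (emb (f2 w x)) (emb w);
  mk (emb x) (emb (f2 w' x)) (emb (f3 x v')); mk (emb x0') (emb v') (emb (f3 x v'));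
  mk (emb x0') (emb (f2 w' x)) (emb w')].
split=> // wt A B C wtE.
rewrite !big_cons !big_nil /t1 /t2 /t3 /t1' /t2' /t3' !wtE -/x0 -/x0'.
by ring.
Qed.
End Cycle.

(** * Subtracting a triangle *)

Section Weights.
Variable W : Type.
(** An arbitrary edge weight summed over a triangle. Equality for all weights means equality of the
    edges with multiplicity, so that exchanges of triangles become ring identities. *)
Definition weight (a b c : W -> W -> int) (t : W * W * W) : int :=
  a t.1.1 t.1.2 + b t.1.2 t.2 + c t.2 t.1.1.
End Weights.

Section CountingEmbedded.
Local Open Scope nat_scope.
Variables (W G : finType) (emb : G -> W) (r : nat).
Hypothesis emb_inj : injective emb.
Hypothesis cardW : #|W| <= #|G| + r.

(** Vertices outside the square, at most [r] of them, are bad for every list: only vertices of [G]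
    have octahedra. *)
Definition bad_ext (Bs : seq {set G}) : {set W} :=
  [set u | ~~ [exists g, (u == emb g) && all (fun B : {set G} => g \notin B) Bs]].

Lemma card_bad_ext Bs : #|bad_ext Bs| <= r + \sum_(B <- Bs) #|B|.
Proof.
pose U := [set g | has (fun B : {set G} => g \in B) Bs].
have cardU : #|U| <= \sum_(B <- Bs) #|B|.
  rewrite {}/U; elim: Bs => [|B Bs IH] /=.
    by rewrite big_nil leqn0 cards_eq0; apply/eqP/setP=> g; rewrite !inE.
  rewrite big_cons; apply: leq_trans (leq_add (leqnn _) IH).
  by apply: leq_trans (card_setUle _ _); apply/subset_leq_card/subsetP=> g; rewrite !inE.
have sub : bad_ext Bs \subset ~: (emb @: setT) :|: (emb @: U).
  apply/subsetP=> u; rewrite !inE; apply: contraR.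
  rewrite negb_or negbK => /andP[/imsetP[g _ eu]]; rewrite eu mem_imset // inE -all_predC => gB.
  by apply/existsP; exists g; rewrite eqxx.
apply: leq_trans (subset_leq_card sub) (leq_trans (card_setUle _ _) _).
rewrite cardsCs setCK !card_imset // cardsT leq_add //.
by rewrite leq_subLR.
Qed.

Lemma notin_bad_ext Bs u : u \notin bad_ext Bs ->
  exists2 g, u = emb g & all (fun B : {set G} => g \notin B) Bs.
Proof. by rewrite inE negbK => /existsP[g /andP[/eqP-> gB]]; exists g. Qed.

Lemma card_emb_preim (A : {set W}) : #|[set g | emb g \in A]| <= #|A|.
Proof. by apply: (card_inj_sub emb_inj) => x; rewrite inE. Qed.

Lemma card_emb_map (T : eqType) (pr : T -> W) (s : seq T) :
  #|[set g | emb g \in map pr s]| <= size s.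
Proof.
rewrite -(size_map pr s); apply: leq_trans (card_mem_seq _).
by apply: (card_inj_sub emb_inj) => x; rewrite !inE.
Qed.

Lemma card_preim_inj (f : G -> G) (P : pred G) : injective f ->
  #|[set g | P (f g)]| <= #|[set g | P g]|.
Proof. by move=> fi; apply: (card_inj_sub fi) => x; rewrite !inE. Qed.

End CountingEmbedded.

Section Removal.
Variables (W G : finType) (emb : G -> W) (r : nat).
Hypothesis emb_inj : injective emb.
Hypothesis cardW : (#|W| <= #|G| + r)%N.
Notation tri := (W * W * W)%type.
Variables (f1 f2 f3 : G -> G -> G) (off : G -> G -> G -> bool).
Hypothesis f13 : forall x y, f1 y (f3 x y) = x.
Hypothesis f23 : forall x y, f2 (f3 x y) x = y.
Hypothesis f31 : forall y z, f3 (f1 y z) y = z.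
Hypothesis f21 : forall y z, f2 z (f1 y z) = y.
Hypothesis f32 : forall z x, f3 x (f2 z x) = z.
Hypothesis f12 : forall z x, f1 (f2 z x) z = x.
Hypothesis off_on : forall x y, off x y (f3 x y) = false.
Hypothesis octahedron : forall x y z, off x y z -> f3 (f1 y z) (f2 z x) = f3 x y.
Variables h tau B d q : nat.
Hypothesis off_card1 : forall y z y' z', (h <= #|[set x | off x y z && off x y' z']|)%N.
Hypothesis off_card3 : forall x y x' y', (h <= #|[set z | off x y z && off x' y' z]|)%N.
Variable L : seq tri.

Let mk (x y z : W) : tri := (x, y, z).
Let mk' (z x y : W) : tri := (x, y, z).
Let good1 := good1st emb mk f3 tau L.
Let good2 := good2nd emb mk f1 tau L.
Let good3 := good3rd emb mk f2 tau L.

Hypothesis bad1 : (#|[set g | ~~ good1 g]| <= B)%N.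
Hypothesis bad2 : (#|[set g | ~~ good2 g]| <= B)%N.
Hypothesis bad3 : (#|[set g | ~~ good3 g]| <= B)%N.
Hypothesis near13 : forall y, near_matching (fun x z => (x, y, z) \in L) d q.
Hypothesis near12 : forall z, near_matching (fun x y => (x, y, z) \in L) d q.
Hypothesis near32 : forall x, near_matching (fun z y => (x, y, z) \in L) d q.
Hypothesis near21 : forall z, near_matching (fun y x => (x, y, z) \in L) d q.
Hypothesis near23 : forall x, near_matching (fun y z => (x, y, z) \in L) d q.

(* The 4-cycle [a'r0 + sp - sr0 - a'p] between the first and third parts, where
   nothing is assumed of [p] and [s].  Either it is half of an intercalate, or a
   vertex [c0] of the second part chosen freely splits it into two 4-cycles on
   good vertices. *)
Lemma mid_cycle (Rm Lc : seq tri) (p s : W) (r0 a' b b' : G) :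
  perm_eq L (Rm ++ Lc) -> p != emb r0 -> s != emb a' ->
  good1 r0 -> good3 a' -> good2 b -> good2 b' ->
  (7 * B + 4 * tau + 2 * d + 2 * q + 2 * r + 6 + 3 * size Rm < #|G|)%N ->
  (6 * tau + 3 * (size Rm + 12) + 2 < h)%N ->
  exists Rm' Lc' Ad, [/\ perm_eq Lc (Rm' ++ Lc'), (size Rm' <= 18)%N &
    forall u v w : W -> W -> int,
      \sum_(t <- Ad) weight u v w t = \sum_(t <- Rm') weight u v w t
        + weight u v w (emb r0, emb b, s) + weight u v w (p, emb b', emb a')
        + (w (emb a') (emb r0) + w s p - w s (emb r0) - w (emb a') p)].
Proof.
move=> pL pr0 sa' gr0 ga' gb gb' ltG lth.
have [bb'|bb'] := eqVneq b b'.
  exists [::], Lc, [:: (emb r0, emb b', emb a'); (p, emb b', s)]; split=> // u v w.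
  by rewrite !big_cons !big_nil /weight bb' /=; ring.
pose Q1 := @bad_ext W G emb [:: [set g | ~~ good1 g]; [set r0]; [set g | emb g == p];
  [set g | (emb g, emb b, emb (f3 g b)) \notin L]; [set g | ~~ good3 (f3 g b)];
  [set g | emb g \in map (fun t : tri => t.1.1) Rm]].
pose Q2 := @bad_ext W G emb [:: [set g | ~~ good3 g]; [set a'];
  [set g | (emb (f1 b' g), emb b', emb g) \notin L]; [set g | ~~ good1 (f1 b' g)];
  [set g | emb g \in map (fun t : tri => t.2) Rm]].
have inj3 y : injective (f3^~ y) by move=> x x' e; rewrite -(f13 x y) e f13.
have inj3' x : injective (f3 x) by move=> y y' e; rewrite -(f23 x y) e f23.
have inj1 y : injective (f1 y) by move=> z z' e; rewrite -(f31 y z) e f31.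
have inj1' z : injective (f1^~ z) by move=> y y' e; rewrite -(f21 y z) e f21.
have tau2 g : good2 g -> (#|[set x | (emb x, emb g, emb (f3 x g)) \notin L]| <= tau)%N.
  by apply: leq_trans; apply: (card_inj_sub (@inj3 g)) => x; rewrite !inE f13.
have tau3 g : good3 g -> (#|[set y | (emb (f1 y g), emb y, emb g) \notin L]| <= tau)%N.
  by apply: leq_trans; apply: (card_inj_sub (@inj1' g)) => y; rewrite !inE f21.
have cardQ1 : (#|Q1| <= r + 2 * B + 2 + tau + size Rm)%N.
  apply: leq_trans (card_bad_ext emb_inj cardW _) _; rewrite !big_cons big_nil cards1.
  have e1 : (#|[set g : G | emb g == p]| <= 1)%N.
    apply: leq_trans (card_emb_map emb_inj id [:: p]).
    by apply/subset_leq_card/subsetP=> g; rewrite !inE.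
  have e2 := leq_trans (card_preim_inj (fun g => ~~ good3 g) (@inj3 b)) bad3.
  have e3 := card_emb_map emb_inj (fun t : tri => t.1.1) Rm.
  have e4 := tau2 b gb.
  apply: (@leq_trans (r + (B + (1 + (1 + (tau + (B + (size Rm + 0))))))))%N; last by clear; lia.
  by rewrite !leq_add.
have cardQ2 : (#|Q2| <= r + 2 * B + 1 + tau + size Rm)%N.
  apply: leq_trans (card_bad_ext emb_inj cardW _) _; rewrite !big_cons big_nil cards1.
  have e2 := leq_trans (card_preim_inj (fun g => ~~ good1 g) (@inj1 b')) bad1.
  have e3 := card_emb_map emb_inj (fun t : tri => t.2) Rm.
  have e4 : (#|[set g | (emb (f1 b' g), emb b', emb g) \notin L]| <= tau)%N := gb'.
  apply: (@leq_trans (r + (B + (1 + (tau + (B + (size Rm + 0)))))))%N; last by clear; lia.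
  by rewrite !leq_add.
(* Excluding [f2 a' r0] makes the square's triangles on the edges [r0 c0] and [c0 a'] different;
   both are removed below. *)
have [|c0 _] := @exists_avoiding G setT [:: [set g | ~~ good2 g]; [set b]; [set b'];
    [set f2 a' r0]; [set g | emb g \in map (fun t : tri => t.1.2) Rm];
    [set g | emb g \in [set y | ~~ [exists x, ((x, y, s) \in L) && (x \notin Q1)]]];
    [set g | emb g \in [set y | ~~ [exists z, ((p, y, z) \in L) && (z \notin Q2)]]];
    [set g | (emb r0, emb g, emb (f3 r0 g)) \notin L]; [set g | ~~ good3 (f3 r0 g)];
    [set g | (emb (f1 g a'), emb g, emb a') \notin L]; [set g | ~~ good1 (f1 g a')]].
  rewrite !big_cons big_nil !cards1 cardsT.
  have e1 := leq_trans (card_emb_preim emb_inj _) (near_matching_avoid Q1 (near21 s)).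
  have e2 := leq_trans (card_emb_preim emb_inj _) (near_matching_avoid Q2 (near23 p)).
  have e3 := card_emb_map emb_inj (fun t : tri => t.1.2) Rm.
  have e4 : (#|[set g | (emb r0, emb g, emb (f3 r0 g)) \notin L]| <= tau)%N := gr0.
  have e5 := leq_trans (card_preim_inj (fun g => ~~ good3 g) (@inj3' r0)) bad3.
  have e6 := leq_trans (card_preim_inj (fun g => ~~ good1 g) (@inj1' a')) bad1.
  have e7 := tau3 a' ga'.
  apply: leq_ltn_trans ltG.
  apply: (@leq_trans (B + (1 + (1 + (1 + (size Rm + ((d + q + #|Q1|) +
    ((d + q + #|Q2|) + (tau + (B + (tau + (B + 0))))))))))))%N;
    last by move: cardQ1 cardQ2; clear; lia.
  by rewrite !leq_add.
rewrite /= andbT => /and5P[h1 h2 h3 h4 /and5P[h5 h6 h7 h8 /and3P[h9 h10 h11]]].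
move: h1 h2 h3 h4 h5 h6 h7 h8 h9 h10 h11; rewrite !inE !negbK.
move=> gc0 c0b c0b' c0f cRm /existsP[p' /andP[p'L /notin_bad_ext[p0 ep0 p0Q]]].
move=> /existsP[a3' /andP[a3L /notin_bad_ext[a3 ea3 a3Q]]] r0L gr0c a'L ga'c.
subst p' a3'.
move: p0Q a3Q; rewrite /= !inE !andbT !negbK.
move=> /and5P[gp0 p0r0 p0p p0L /andP[gp0b p0Rm]] /and5P[ga3 a3a' a3L' ga3b a3Rm].
(* Trading the first two triangles and the two of the statement for [r0 c0 a'], [p c0 s], [p0 b s]
   and [p b' a3] gives the required cycle, up to a 4-cycle on [c0, b', a', a3] and one on
   [r0, p0, c0, b]. The last four triangles are those that [four_cycle] leaves to its caller. *)
pose R1 : seq tri := [:: (emb p0, emb c0, s); (p, emb c0, emb a3);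
  (emb r0, emb c0, emb (f3 r0 c0)); (emb p0, emb b, emb (f3 p0 b));
  (emb (f1 c0 a'), emb c0, emb a'); (emb (f1 b' a3), emb b', emb a3)].
have uR1 : uniq R1.
  have n1 : (p == emb p0) = false by rewrite eq_sym (negPf p0p).
  have n2 : (a' == a3) = false by rewrite eq_sym (negPf a3a').
  have n3 : (r0 == f1 c0 a') = false.
    by apply: contraNF c0f => /eqP->; rewrite f21.
  rewrite /= !inE !xpair_eqE !(inj_eq emb_inj).
  rewrite (negPf p0p) (negPf p0r0) (negPf c0b) (negPf c0b') (negPf bb') (negPf sa').
  by rewrite (negPf pr0) (negPf a3a') n1 n2 n3 [b == c0]eq_sym (negPf c0b) !andbF.
have sub : {subset R1 <= Lc}.
  have in_Lc t : t \in L -> t \notin Rm -> t \in Lc.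
    by rewrite (perm_mem pL) mem_cat => /orP[->|].
  have c0P x z : (x, emb c0, z) \notin Rm.
    by apply: contraNN cRm => xRm; apply/mapP; exists (x, emb c0, z).
  have p0P y z : (emb p0, y, z) \notin Rm.
    by apply: contraNN p0Rm => xRm; apply/mapP; exists (emb p0, y, z).
  have a3P x y : (x, y, emb a3) \notin Rm.
    by apply: contraNN a3Rm => xRm; apply/mapP; exists (x, y, emb a3).
  by move=> t; rewrite !inE => /orP[|/orP[|/orP[|/orP[|/orP[|]]]]] /eqP->; apply: in_Lc.
have [Lc1 pLc1] := perm_cat_uniq uR1 sub.
have pL1 : perm_eq L ((Rm ++ R1) ++ Lc1).
  by rewrite -catA; apply: perm_trans pL _; rewrite perm_cat2l.
have [|||||R2 [Lc2 [A2 [pLc2 sR2 eA2]]]] := @four_cycle W G emb emb_inj tri mk (fun t => t.1.1)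
  (fun t => t.1.2) _ _ _ f1 f2 f3 off h tau f13 f31 f32 f12 off_on octahedron off_card1
  L (Rm ++ R1) Lc1 c0 b' a' a3 pL1 c0b' _ gc0 gb' ga' ga3 ga'c ga3b _ => //.
- by move=> x y z x' y' z' [-> -> ->].
- by rewrite eq_sym.
- by apply: leq_ltn_trans lth; rewrite size_cat leq_add2r leq_add2l leq_mul2l leq_add2l.
have pL2 : perm_eq L (((Rm ++ R1) ++ R2) ++ Lc2).
  by rewrite -catA; apply: perm_trans pL1 _; rewrite perm_cat2l.
have [|||||||R3 [Lc3 [A3 [pLc3 sR3 eA3]]]] := @four_cycle W G emb emb_inj tri mk' (fun t => t.2)
  (fun t => t.1.1) _ _ _ f3 f1 f2 (fun z x y => off x y z) h tau
  f32 f23 f21 f31 _ _ (fun x y x' y' => off_card3 x y x' y')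
  L ((Rm ++ R1) ++ R2) Lc2 r0 p0 c0 b pL2 _ c0b gr0 gp0 gc0 gb gr0c gp0b _ => //.
- by move=> x y z x' y' z' [-> -> ->].
- by move=> z x /=; rewrite -[X in off _ _ X](f32 z x) off_on.
- by move=> z x y o; rewrite -(f23 (f1 y z) (f2 z x)) octahedron.
- by rewrite eq_sym.
- apply: leq_ltn_trans lth; rewrite !size_cat sR2 leq_add2r leq_add2l leq_mul2l.
  by rewrite -addnA leq_add2l.
exists (R1 ++ R2 ++ R3), Lc3, ([:: (emb r0, emb c0, emb a'); (p, emb c0, s);
  (emb p0, emb b, s); (p, emb b', emb a3)] ++ A2 ++ A3); split.
- rewrite -!catA; apply: perm_trans pLc1 _; rewrite perm_cat2l.
  by apply: perm_trans pLc2 _; rewrite perm_cat2l.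
- by rewrite !size_cat sR2 sR3.
move=> u v w; rewrite !big_cat /= (eA2 (weight u v w) u v w) //.
rewrite (eA3 (weight u v w) w u v); last by move=> x y z; rewrite /weight /=; ring.
by rewrite !big_cons !big_nil /weight /=; ring.
Qed.

(* Flipping the octahedron on [x, x1], [y, y1], [z, z1] would need the triangle
   [x1 y1 z1] in [L].  A vertex [u] chosen freely in the first part trades this
   defect for two 4-cycles that meet it, to which [mid_cycle] applies. *)
Lemma remove_triangle (x y z x1 y1 z1 : W) :
  (x, y, z1) \in L -> (x, y1, z) \in L -> (x1, y, z) \in L ->
  (7 * B + 4 * tau + 2 * d + 2 * q + 2 * r + 87 < #|G|)%N ->
  (7 * B + 6 * d + 6 * q + 6 * r + 6 < #|G|)%N ->
  (6 * tau + 119 < h)%N ->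
  exists Rm Lc Ad, [/\ perm_eq L (Rm ++ Lc), (size Rm <= 45)%N &
    forall u v w : W -> W -> int,
      \sum_(t <- Ad) weight u v w t + weight u v w (x, y, z)
        = \sum_(t <- Rm) weight u v w t].
Proof.
move=> Lz1 Ly1 Lx1 ltG ltG' lth.
have [TL|TL] := boolP ((x, y, z) \in L).
  have [||Lc pLc] := @perm_cat_uniq _ [:: (x, y, z)] L => //.
    by move=> t; rewrite inE => /eqP->.
  exists [:: (x, y, z)], Lc, [::]; split=> // u v w.
  by rewrite !big_cons !big_nil add0r addr0.
have zz1 : (z == z1) = false by apply: contraNF TL => /eqP->.
have yy1 : (y == y1) = false by apply: contraNF TL => /eqP->.
have xx1 : (x == x1) = false by apply: contraNF TL => /eqP->.
pose QY := @bad_ext W G emb [:: [set g | ~~ good2 g]].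
(* The third set is there for [mid_cycle]: the edge from [z2] to [x1], or from [z3] to [x], must lie
   in a triangle of [L] whose second vertex is good. *)
pose QZ v := @bad_ext W G emb [:: [set g | ~~ good3 g]; [set g | emb g \in map id [:: z; z1]];
  [set g | emb g \in [set z | ~~ [exists y, ((v, y, z) \in L) && (y \notin QY)]]]].
have cardQY : (#|QY| <= r + B)%N.
  by apply: leq_trans (card_bad_ext emb_inj cardW _) _; rewrite big_seq1 leq_add.
have cardQZ v : (#|QZ v| <= r + (B + (2 + (d + q + (r + B)))))%N.
  apply: leq_trans (card_bad_ext emb_inj cardW _) _; rewrite !big_cons big_nil addn0.
  rewrite !leq_add //; first exact: leq_trans (card_emb_map emb_inj _ _) _.
  apply: leq_trans (card_emb_preim emb_inj _) _.
  by apply: leq_trans (near_matching_avoid QY (near32 v)) _; rewrite leq_add.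
have [|u _] := @exists_avoiding G setT [:: [set g | ~~ good1 g];
    [set g | emb g \in map id [:: x; x1]];
    [set g | emb g \in [set v | ~~ [exists z, ((v, y, z) \in L) && (z \notin QZ x1)]]];
    [set g | emb g \in [set v | ~~ [exists z, ((v, y1, z) \in L) && (z \notin QZ x)]]];
    [set g | emb g \in [set v | ~~ [exists y, ((v, y, z) \in L) && (y \notin QY)]]];
    [set g | emb g \in [set v | ~~ [exists y, ((v, y, z1) \in L) && (y \notin QY)]]]].
  rewrite !big_cons big_nil cardsT; apply: leq_ltn_trans ltG'.
  have e1 := leq_trans (card_emb_preim emb_inj _) (near_matching_avoid (QZ x1) (near13 y)).
  have e2 := leq_trans (card_emb_preim emb_inj _) (near_matching_avoid (QZ x) (near13 y1)).
  have e3 := leq_trans (card_emb_preim emb_inj _) (near_matching_avoid QY (near12 z)).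
  have e4 := leq_trans (card_emb_preim emb_inj _) (near_matching_avoid QY (near12 z1)).
  have e5 := card_emb_map emb_inj id [:: x; x1].
  apply: (@leq_trans (B + (2 + (d + q + #|QZ x1| + (d + q + #|QZ x| +
    (d + q + #|QY| + (d + q + #|QY| + 0)))))))%N; last first.
    by move: cardQY (cardQZ x) (cardQZ x1); clear; lia.
  by rewrite !leq_add.
rewrite /= andbT !inE !negbK => /and5P[gu].
rewrite !negb_or => /andP[ux ux1].
move=> /existsP[w2 /andP[Lz2 /notin_bad_ext[z2 ew2 z2Q]]].
move=> /existsP[w3 /andP[Lz3 /notin_bad_ext[z3 ew3 z3Q]]].
move=> /andP[/existsP[v2 /andP[Ly2 /notin_bad_ext[y2 ev2 y2Q]]]].
move=> /existsP[v4 /andP[Ly4 /notin_bad_ext[y4 ev4 y4Q]]].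
subst w2 w3 v2 v4.
move: z2Q z3Q y2Q y4Q; rewrite /= !inE !andbT !negbK !negb_or.
move=> /and3P[gz2 /andP[z2z z2z1] /existsP[v3 /andP[Ly3 /notin_bad_ext[y3 ev3 y3Q]]]].
move=> /and3P[gz3 /andP[z3z z3z1] /existsP[v5 /andP[Ly5 /notin_bad_ext[y5 ev5 y5Q]]]].
subst v3 v5.
move: y3Q y5Q; rewrite /= !inE !andbT !negbK => gy3 gy5 gy2 gy4.
(* Trading the first five triangles for [x1 y z2], [x y1 z3], [u y z1] and [u y1 z] subtracts the
   edges [x y] and [y z], and leaves two 4-cycles between the third and first parts. The other four
   triangles are those that [mid_cycle] leaves to its caller. With 18 removals for each cycle the
   total is 9 + 18 + 18 = 45. *)
pose R0 : seq tri := [:: (x, y, z1); (x, y1, z); (x1, y, z); (emb u, y, emb z2);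
  (emb u, y1, emb z3); (emb u, emb y2, z); (x1, emb y3, emb z2); (emb u, emb y4, z1);
  (x, emb y5, emb z3)].
have uR0 : uniq R0.
  rewrite /= !inE !xpair_eqE zz1 yy1 xx1 ![_ == emb u]eq_sym ![_ == emb z2]eq_sym.
  rewrite ![_ == emb z3]eq_sym (negPf ux) (negPf ux1) (negPf z2z) (negPf z2z1).
  by rewrite (negPf z3z) (negPf z3z1) ![x1 == x]eq_sym ![z1 == z]eq_sym zz1 xx1 ?andbF.
have sub : {subset R0 <= L}.
  move=> t; rewrite !inE.
  by move=> /orP[|/orP[|/orP[|/orP[|/orP[|/orP[|/orP[|/orP[|]]]]]]]] /eqP->.
have [L0 pL0] := perm_cat_uniq uR0 sub.
have [||||R1 [L1 [A1 [pL1 sR1 eA1]]]] := @mid_cycle R0 L0 x1 z u z2 y2 y3 pL0 _ _ gu gz2 gy2 gy3 => //.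
- by rewrite eq_sym.
- by rewrite eq_sym.
- by apply: leq_ltn_trans ltG; rewrite /R0 /= -addnA leq_add2l.
- by apply: leq_ltn_trans lth; rewrite /R0 /= -addnA leq_add2l.
have pL0' : perm_eq L ((R0 ++ R1) ++ L1).
  by rewrite -catA; apply: perm_trans pL0 _; rewrite perm_cat2l.
have sR01 : (size (R0 ++ R1) <= 27)%N by rewrite size_cat /=; apply: (@leq_add 9 _ 9 18).
have [||||R2 [L2 [A2 [pL2 sR2 eA2]]]] := @mid_cycle (R0 ++ R1) L1 x z1 u z3 y4 y5 pL0' _ _ gu gz3 gy4 gy5 => //.
- by rewrite eq_sym.
- by rewrite eq_sym.
- by apply: leq_ltn_trans ltG; rewrite -addnA leq_add2l (@leq_add 6 _ 6 81) // (@leq_mul 3 _ 3 27).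
- apply: leq_ltn_trans lth; rewrite -addnA leq_add2l.
  by rewrite (@leq_add _ 2 117 2) // (@leq_mul 3 _ 3 39) // (@leq_add _ 12 27 12).
exists (R0 ++ R1 ++ R2), L2, ([:: (x1, y, emb z2); (x, y1, emb z3); (emb u, y, z1); (emb u, y1, z)] ++ A1 ++ A2); split.
- rewrite -!catA; apply: perm_trans pL0 _; rewrite perm_cat2l.
  by apply: perm_trans pL1 _; rewrite perm_cat2l.
- by rewrite catA size_cat (@leq_add _ _ 27 18).
move=> f g k; rewrite !big_cat /= eA1 eA2.
by rewrite !big_cons !big_nil /weight /=; ring.
Qed.
End Removal.

(** * Following the missing edges *)

Section NearCount.
Local Open Scope nat_scope.

Lemma sum_count_mem (V T : finType) (X : seq T) (f : V -> T) : injective f ->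
  \sum_v count_mem (f v) X <= size X.
Proof.
move=> fi; elim: X => [|p X IH] /=; first by rewrite big1.
rewrite big_split /= -add1n; apply: leq_add => //.
have [v0 /eqP e|no] := pickP (fun v => p == f v); last by rewrite big1 // => v _; rewrite no.
rewrite (bigD1 v0) //= big1 ?addn0 ?leq_b1 // => v vv0.
by rewrite e (inj_eq fi) eq_sym (negPf vv0).
Qed.

Lemma near_matching_seq (U V : finType) (E : U -> V -> bool) (P : seq (U * V)) d q :
  (forall u v, E u v = ((u, v) \in P)) ->
  #|[set u | count (fun p => p.1 == u) P == 0]| <= d ->
  \sum_v (count (fun p => p.2 == v) P).-1 <= q -> near_matching E d q.
Proof.
move=> EP hd hq; split.
  apply: leq_trans hd; apply/subset_leq_card/subsetP=> u; rewrite !inE => /existsPn noE.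
  rewrite -leqn0 leqNgt -has_count; apply/negP => /hasP[[u' v] pP /= /eqP e].
  by move: (noE v); rewrite EP -e pP.
apply: leq_trans hq; apply: leq_sum => v _.
suff : #|[set u | E u v]| <= count (fun p => p.2 == v) P by lia.
rewrite -size_filter -(size_map fst); apply: leq_trans (card_size _).
apply/subset_leq_card/subsetP=> u; rewrite inE EP => uvP.
by apply/mapP; exists (u, v); rewrite // mem_filter eqxx.
Qed.
End NearCount.

Section Walk.
Variables (W G : finType) (emb : G -> W) (r : nat).
Hypothesis emb_inj : injective emb.
Hypothesis cardW : (#|W| <= #|G| + r)%N.
Notation tri := (W * W * W)%type.
Variables (f1 f2 f3 : G -> G -> G) (off : G -> G -> G -> bool).
Hypothesis f13 : forall x y, f1 y (f3 x y) = x.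
Hypothesis f23 : forall x y, f2 (f3 x y) x = y.
Hypothesis f31 : forall y z, f3 (f1 y z) y = z.
Hypothesis f21 : forall y z, f2 z (f1 y z) = y.
Hypothesis f32 : forall z x, f3 x (f2 z x) = z.
Hypothesis f12 : forall z x, f1 (f2 z x) z = x.
Hypothesis off_on : forall x y, off x y (f3 x y) = false.
Hypothesis octahedron : forall x y z, off x y z -> f3 (f1 y z) (f2 z x) = f3 x y.
Variables h t B d K : nat.
Hypothesis off_card1 : forall y z y' z', (h <= #|[set x | off x y z && off x y' z']|)%N.
Hypothesis off_card3 : forall x y x' y', (h <= #|[set z | off x y z && off x' y' z]|)%N.

(* Triangles of the Latin square on [G] that are not available from the start.
   *)
Variable Th : {set G * G}.
Hypothesis Th1 : forall x, (#|[set y | (x, y) \in Th]| <= r)%N.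
Hypothesis Th2 : forall y, (#|[set z | (f1 y z, y) \in Th]| <= r)%N.
Hypothesis Th3 : forall z, (#|[set x | (x, f2 z x) \in Th]| <= r)%N.

Definition total (u v w : W -> W -> int) : int :=
  \sum_x \sum_y (u x y + v x y + w x y).
Definition esum (s : seq (W * W)) (u : W -> W -> int) : int :=
  \sum_(p <- s) u p.1 p.2.

(* Tested on all edge weights: [L] covers every edge once, the edges in the sets
   [F] being omitted and those listed in the [X] being covered once more. *)
Definition covers (L : seq tri) (F12 F23 F31 : {set W * W}) (X12 X23 X31 : seq (W * W)) :=
  forall u v w : W -> W -> int,
    \sum_(s <- L) weight u v w s + (esum (enum F12) u + esum (enum F23) v + esum (enum F31) w)
    = total u v w + (esum X12 u + esum X23 v + esum X31 w).

(** The triangles in [Th] are left out because they are accounted for separately, by at most [r] at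
    each vertex. *)
Definition lost (L : seq tri) : {set G * G} :=
  [set p | (p \notin Th) && ((emb p.1, emb p.2, emb (f3 p.1 p.2)) \notin L)].

Section Counts.
Variables (L : seq tri) (F12 F23 F31 : {set W * W}) (X12 X23 X31 : seq (W * W)).
Hypothesis cov : covers L F12 F23 F31 X12 X23 X31.

(** The weight of a single edge: testing [covers] on it recovers the multiplicity of that edge. *)
Let dl (x y a b : W) : int := ((x == a) && (y == b))%:R.

Lemma esum_delta (s : seq (W * W)) x y : esum s (dl x y) = (count_mem (x, y) s)%:R.
Proof.
rewrite /esum -sum1_count natr_sum [RHS]big_mkcond /=; apply: eq_bigr => -[a b] _ /=.
by rewrite /dl xpair_eqE [a == _]eq_sym [b == _]eq_sym; case: ifP.
Qed.

Lemma esum0 (s : seq (W * W)) : esum s (fun _ _ => 0) = 0.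
Proof. by rewrite /esum big1. Qed.

Lemma total_delta x y : \sum_a \sum_b dl x y a b = 1.
Proof.
rewrite (bigD1 x) //= (bigD1 y) //= /dl !eqxx big1 => [|b yb]; last first.
  by rewrite eq_sym (negPf yb).
by rewrite big1 ?addr0 // => a xa; rewrite big1 // => b _; rewrite eq_sym (negPf xa).
Qed.

Lemma count_enum_set (F : {set W * W}) p : count_mem p (enum F) = (p \in F).
Proof. by rewrite count_uniq_mem ?enum_uniq // mem_enum. Qed.

Lemma cov12 x y : (count (fun s => (s.1.1 == x) && (s.1.2 == y)) L + ((x, y) \in F12)
  = 1 + count_mem (x, y) X12)%N.
Proof.
apply/eqP; rewrite -(eqr_nat int) !natrD; apply/eqP.
have := cov (dl x y) (fun _ _ => 0) (fun _ _ => 0).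
have -> : total (dl x y) (fun _ _ => 0) (fun _ _ => 0) = 1.
  rewrite -(total_delta x y); apply: eq_bigr => a _; apply: eq_bigr => b _.
  by rewrite ?addr0 ?add0r.
rewrite !esum0 !esum_delta count_enum_set !(addr0, add0r) => <-; congr (_ + _).
rewrite -sum1_count natr_sum [LHS]big_mkcond /=; apply: eq_bigr => s _.
by rewrite /weight /dl !addr0 [x == _]eq_sym [y == _]eq_sym; case: ifP.
Qed.

Lemma cov23 y z : (count (fun s => (s.1.2 == y) && (s.2 == z)) L + ((y, z) \in F23)
  = 1 + count_mem (y, z) X23)%N.
Proof.
apply/eqP; rewrite -(eqr_nat int) !natrD; apply/eqP.
have := cov (fun _ _ => 0) (dl y z) (fun _ _ => 0).
have -> : total (fun _ _ => 0) (dl y z) (fun _ _ => 0) = 1.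
  rewrite -(total_delta y z); apply: eq_bigr => a _; apply: eq_bigr => b _.
  by rewrite ?addr0 ?add0r.
rewrite !esum0 !esum_delta count_enum_set !(addr0, add0r) => <-; congr (_ + _).
rewrite -sum1_count natr_sum [LHS]big_mkcond /=; apply: eq_bigr => s _.
by rewrite /weight /dl add0r addr0 [y == _]eq_sym [z == _]eq_sym; case: ifP.
Qed.

Lemma cov31 z x : (count (fun s => (s.2 == z) && (s.1.1 == x)) L + ((z, x) \in F31)
  = 1 + count_mem (z, x) X31)%N.
Proof.
apply/eqP; rewrite -(eqr_nat int) !natrD; apply/eqP.
have := cov (fun _ _ => 0) (fun _ _ => 0) (dl z x).
have -> : total (fun _ _ => 0) (fun _ _ => 0) (dl z x) = 1.
  rewrite -(total_delta z x); apply: eq_bigr => a _; apply: eq_bigr => b _.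
  by rewrite ?addr0 ?add0r.
rewrite !esum0 !esum_delta count_enum_set !(addr0, add0r) => <-; congr (_ + _).
rewrite -sum1_count natr_sum [LHS]big_mkcond /=; apply: eq_bigr => s _.
by rewrite /weight /dl !add0r [z == _]eq_sym [x == _]eq_sym; case: ifP.
Qed.

Hypothesis d12 : forall x, (#|[set y | (x, y) \in F12]| <= d)%N.
Hypothesis d21 : forall y, (#|[set x | (x, y) \in F12]| <= d)%N.
Hypothesis d32 : forall z, (#|[set y | (y, z) \in F23]| <= d)%N.
Hypothesis d31 : forall z, (#|[set x | (z, x) \in F31]| <= d)%N.
Hypothesis d13 : forall x, (#|[set z | (z, x) \in F31]| <= d)%N.
Hypothesis sX12 : (size X12 <= 2)%N.
Hypothesis sX23 : (size X23 <= 2)%N.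
Hypothesis sX31 : (size X31 <= 2)%N.

Let excess (V : finType) (c k : V -> nat) (X : seq (W * W)) (f : V -> W * W) :
  injective f -> (size X <= 2)%N -> (forall v, (c v + k v = 1 + count_mem (f v) X)%N) ->
  (\sum_v (c v).-1 <= 2)%N.
Proof.
move=> fi sX e; apply: leq_trans sX; apply: leq_trans (sum_count_mem X fi).
by apply: leq_sum => v _; rewrite -subn1 leq_subLR -(e v) leq_addr.
Qed.

Lemma near13 y : near_matching (fun x z => (x, y, z) \in L) d 2.
Proof.
apply: (@near_matching_seq _ _ _ [seq (s.1.1, s.2) | s <- L & s.1.2 == y]).
- move=> x z; apply/idP/mapP => [m|[[[a b] c]]].
    by exists (x, y, z); rewrite // mem_filter eqxx.
  by rewrite mem_filter /= => /andP[/eqP-> m] [-> ->].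
- apply: leq_trans (d21 y); apply/subset_leq_card/subsetP=> x; rewrite !inE count_map count_filter => /eqP c0.
  have := cov12 x y; rewrite (_ : count _ L = 0)%N; first by case: (_ \in F12).
  by rewrite -c0; apply: eq_count => s /=; rewrite andbC.
- apply: (@excess _ _ (fun z => (y, z) \in F23 : nat) X23 (fun z => (y, z))) => // [a b []//|z].
  rewrite -cov23 count_map count_filter; congr (_ + _)%N.
  by apply: eq_count => s /=; rewrite andbC.
Qed.

Lemma near12 z : near_matching (fun x y => (x, y, z) \in L) d 2.
Proof.
apply: (@near_matching_seq _ _ _ [seq (s.1.1, s.1.2) | s <- L & s.2 == z]).
- move=> x y; apply/idP/mapP => [m|[[[a b] c]]].
    by exists (x, y, z); rewrite // mem_filter eqxx.
  by rewrite mem_filter /= => /andP[/eqP-> m] [-> ->].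
- apply: leq_trans (d31 z); apply/subset_leq_card/subsetP=> x; rewrite !inE count_map count_filter => /eqP c0.
  have := cov31 z x; rewrite (_ : count _ L = 0)%N; first by case: (_ \in F31).
  by rewrite -c0; apply: eq_count => s /=; rewrite andbC.
- apply: (@excess _ _ (fun y => (y, z) \in F23 : nat) X23 (fun y => (y, z))) => // [a b []//|y].
  by rewrite -cov23 count_map count_filter.
Qed.

Lemma near32 x : near_matching (fun z y => (x, y, z) \in L) d 2.
Proof.
apply: (@near_matching_seq _ _ _ [seq (s.2, s.1.2) | s <- L & s.1.1 == x]).
- move=> z y; apply/idP/mapP => [m|[[[a b] c]]].
    by exists (x, y, z); rewrite // mem_filter eqxx.
  by rewrite mem_filter /= => /andP[/eqP-> m] [-> ->].
- apply: leq_trans (d13 x); apply/subset_leq_card/subsetP=> z; rewrite !inE count_map count_filter => /eqP c0.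
  have := cov31 z x; rewrite (_ : count _ L = 0)%N; first by case: (_ \in F31).
  by rewrite -c0; apply: eq_count => s /=; rewrite andbC.
- apply: (@excess _ _ (fun y => (x, y) \in F12 : nat) X12 (fun y => (x, y))) => // [a b []//|y].
  rewrite -cov12 count_map count_filter; congr (_ + _)%N.
  by apply: eq_count => s /=; rewrite andbC.
Qed.

Lemma near21 z : near_matching (fun y x => (x, y, z) \in L) d 2.
Proof.
apply: (@near_matching_seq _ _ _ [seq (s.1.2, s.1.1) | s <- L & s.2 == z]).
- move=> y x; apply/idP/mapP => [m|[[[a b] c]]].
    by exists (x, y, z); rewrite // mem_filter eqxx.
  by rewrite mem_filter /= => /andP[/eqP-> m] [-> ->].
- apply: leq_trans (d32 z); apply/subset_leq_card/subsetP=> y; rewrite !inE count_map count_filter => /eqP c0.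
  have := cov23 y z; rewrite (_ : count _ L = 0)%N; first by case: (_ \in F23).
  by rewrite -c0; apply: eq_count => s /=; rewrite andbC.
- apply: (@excess _ _ (fun x => (z, x) \in F31 : nat) X31 (fun x => (z, x))) => // [a b []//|x].
  rewrite -cov31 count_map count_filter; congr (_ + _)%N.
  by apply: eq_count => s /=; rewrite andbC.
Qed.

Lemma near23 x : near_matching (fun y z => (x, y, z) \in L) d 2.
Proof.
apply: (@near_matching_seq _ _ _ [seq (s.1.2, s.2) | s <- L & s.1.1 == x]).
- move=> y z; apply/idP/mapP => [m|[[[a b] c]]].
    by exists (x, y, z); rewrite // mem_filter eqxx.
  by rewrite mem_filter /= => /andP[/eqP-> m] [-> ->].
- apply: leq_trans (d12 x); apply/subset_leq_card/subsetP=> y; rewrite !inE count_map count_filter => /eqP c0.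
  have := cov12 x y; rewrite (_ : count _ L = 0)%N; first by case: (_ \in F12).
  by rewrite -c0; apply: eq_count => s /=; rewrite andbC.
- apply: (@excess _ _ (fun z => (z, x) \in F31 : nat) X31 (fun z => (z, x))) => // [a b []//|z].
  by rewrite -cov31 count_map count_filter.
Qed.

(** An edge at [hub] may itself be missing. If it has been omitted but is listed in [X12], it is
    still covered, which is the second alternative. *)
Lemma exists_third x y : ((x, y) \notin F12) || ((x, y) \in X12) -> exists z, (x, y, z) \in L.
Proof.
move=> xy; have : (0 < count (fun s => (s.1.1 == x) && (s.1.2 == y)) L)%N.
  have := cov12 x y; case/orP: xy => [/negPf->|]; first by rewrite addn0 => ->.
  rewrite -has_pred1 has_count; case: (count_mem _ _) => // k _.
  by case: (_ \in F12) => //=; case: (count _ L).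
by rewrite -has_count => /hasP[[[a b] c] m /= /andP[/eqP<- /eqP<-]]; exists c.
Qed.

Lemma exists_first y z : ((y, z) \notin F23) || ((y, z) \in X23) -> exists x, (x, y, z) \in L.
Proof.
move=> xy; have : (0 < count (fun s => (s.1.2 == y) && (s.2 == z)) L)%N.
  have := cov23 y z; case/orP: xy => [/negPf->|]; first by rewrite addn0 => ->.
  rewrite -has_pred1 has_count; case: (count_mem _ _) => // k _.
  by case: (_ \in F23) => //=; case: (count _ L).
by rewrite -has_count => /hasP[[[a b] c] m /= /andP[/eqP<- /eqP<-]]; exists a.
Qed.

Lemma exists_second z x : ((z, x) \notin F31) || ((z, x) \in X31) -> exists y, (x, y, z) \in L.
Proof.
move=> xy; have : (0 < count (fun s => (s.2 == z) && (s.1.1 == x)) L)%N.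
  have := cov31 z x; case/orP: xy => [/negPf->|]; first by rewrite addn0 => ->.
  rewrite -has_pred1 has_count; case: (count_mem _ _) => // k _.
  by case: (_ \in F31) => //=; case: (count _ L).
by rewrite -has_count => /hasP[[[a b] c] m /= /andP[/eqP<- /eqP<-]]; exists b.
Qed.

(** Averaging: a bad vertex lacks more than t + r triangles, at most [r] of them because of [Th], so
    B + 1 bad vertices would account for (B+1)(t+1) lost triangles. The map [phi] adapts the count
    to each of the three parts. *)
Let card_bad (phi : G -> G -> G * G) (A : {set G * G}) (P : G -> G -> bool) :
  (forall g y g' y', phi g y = phi g' y' -> (g, y) = (g', y')) ->
  (forall g, #|[set y | phi g y \in Th]| <= r)%N ->
  (forall g y, P g y -> (phi g y \in Th) || (phi g y \in A)) ->
  (#|A| < B.+1 * t.+1)%N ->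
  (#|[set g | ~~ (#|[set y | P g y]| <= t + r)%N]| <= B)%N.
Proof.
move=> phi_inj phiTh PA ltA; rewrite -ltnS -(@ltn_pmul2r t.+1) //.
apply: leq_ltn_trans ltA; set S := [set g | _].
apply: (@leq_trans (\sum_(g in S) #|[set y | phi g y \in A]|)%N).
  rewrite -sum_nat_const; apply: leq_sum => g; rewrite inE -ltnNge => gS.
  have sub : [set y | P g y] \subset [set y | phi g y \in Th] :|: [set y | phi g y \in A].
    by apply/subsetP=> y; rewrite !inE => /PA.
  rewrite -(leq_add2l r) addnS [(r + t)%N]addnC.
  apply: leq_trans gS (leq_trans (subset_leq_card sub) _).
  by apply: leq_trans (card_setUle _ _) _; rewrite leq_add2r.
apply: (@leq_trans (\sum_g #|[set y | phi g y \in A]|)%N).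
  by rewrite [leqRHS](bigID (mem S)) leq_addr.
rewrite (eq_bigr (fun g => \sum_(y | phi g y \in A) 1)%N); last first.
  by move=> g _; rewrite sum1dep_card.
rewrite pair_big_dep sum1dep_card.
apply: (@card_inj_sub _ _ (fun p => phi p.1 p.2)).
  by move=> [g y] [g' y'] /phi_inj.
by move=> p; rewrite !inE.
Qed.

Hypothesis num1 : (7 * B + 4 * (t + r) + 2 * d + 2 * 2 + 2 * r + 87 < #|G|)%N.
Hypothesis num2 : (7 * B + 6 * d + 6 * 2 + 6 * r + 6 < #|G|)%N.
Hypothesis num3 : (6 * (t + r) + 119 < h)%N.

Lemma subtract_triangle x y z :
  ((x, y) \notin F12) || ((x, y) \in X12) ->
  ((y, z) \notin F23) || ((y, z) \in X23) ->
  ((z, x) \notin F31) || ((z, x) \in X31) ->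
  (#|lost L| < B.+1 * t.+1)%N ->
  exists2 L', forall u v w, \sum_(s <- L') weight u v w s + weight u v w (x, y, z)
    = \sum_(s <- L) weight u v w s & (#|lost L'| <= #|lost L| + 45)%N.
Proof.
move=> /exists_third[z1 Lz] /exists_first[x1 Lx] /exists_second[y1 Ly] ltL.
pose tr (p : G * G) := (emb p.1, emb p.2, emb (f3 p.1 p.2)).
have lostP p : tr p \notin L -> (p \in Th) || (p \in lost L).
  by rewrite !inE => ->; rewrite andbT orbN.
have [||||||Rm [Lc [Ad [pL sRm eAd]]]] := @remove_triangle W G emb r emb_inj cardW f1 f2 f3 off
  f13 f23 f31 f21 f32 f12 off_on octahedron h (t + r) B d 2 off_card1 off_card3 L
  _ _ _ near13 near12 near32 near21 near23 x y z x1 y1 z1 Lz Ly Lx => //.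
- apply: (@card_bad (fun g y => (g, y)) (lost L)) => // g v.
  exact: (lostP (g, v)).
- apply: (@card_bad (fun g z => (f1 g z, g)) (lost L)) => // [g v g' v' [e eg]|g v].
    by rewrite -[v](f31 g v) e eg f31.
  by move=> h'; apply: lostP; rewrite /tr /= f31.
- apply: (@card_bad (fun g x => (x, f2 g x)) (lost L)) => // [g v g' v' [eg e]|g v].
    by rewrite -[g](f32 g v) e eg f32.
  by move=> h'; apply: lostP; rewrite /tr /= f32.
exists (Ad ++ Lc) => [u v w|].
  by rewrite (perm_big _ pL) !big_cat /= -eAd addrAC.
apply: (@leq_trans #|lost L :|: [set p | tr p \in Rm]|).
  apply/subset_leq_card/subsetP=> p; rewrite !inE => /andP[-> /=].
  by rewrite -/(tr p) mem_cat negb_or (perm_mem pL) mem_cat => /andP[_ /negPf->]; rewrite orbF orNb.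
apply: leq_trans (card_setUle _ _) _; rewrite leq_add2l; apply: leq_trans sRm.
apply: leq_trans (card_mem_seq _); apply: (@card_inj_sub _ _ tr) => [[a b] [a' b']|p].
  by case=> /emb_inj-> /emb_inj->.
by rewrite !inE.
Qed.
End Counts.

(** All parts are identified with [W], and missing edges are oriented from each part to the next;
    the degree condition then says that every vertex has as many missing edges going out as coming
    in. *)
Definition outdeg (S : {set W * W}) a := #|[set b | (a, b) \in S]|.
Definition indeg (S : {set W * W}) b := #|[set a | (a, b) \in S]|.

Lemma outdegU1 (S : {set W * W}) p a : p \notin S ->
  outdeg (p |: S) a = (outdeg S a + (a == p.1))%N.
Proof.
case: p => p1 p2 pS; rewrite /outdeg /=; have [->|ap] := eqVneq a p1.
  rewrite (_ : [set b | _] = p2 |: [set b | (p1, b) \in S]); last first.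
    by apply/setP=> b; rewrite !inE xpair_eqE eqxx.
  by rewrite cardsU1 inE pS addnC.
by rewrite addn0; apply: eq_card => b; rewrite !inE xpair_eqE (negPf ap).
Qed.

Lemma indegU1 (S : {set W * W}) p b : p \notin S ->
  indeg (p |: S) b = (indeg S b + (b == p.2))%N.
Proof.
case: p => p1 p2 pS; rewrite /indeg /=; have [->|ap] := eqVneq b p2.
  rewrite (_ : [set b | _] = p1 |: [set a | (a, p2) \in S]); last first.
    by apply/setP=> a; rewrite !inE xpair_eqE eqxx andbT.
  by rewrite cardsU1 inE pS addnC.
by rewrite addn0; apply: eq_card => a; rewrite !inE xpair_eqE (negPf ap) andbF.
Qed.

Lemma outdegS (S S' : {set W * W}) a : S \subset S' -> (outdeg S a <= outdeg S' a)%N.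
Proof. by move=> /subsetP sub; apply/subset_leq_card/subsetP=> b; rewrite !inE => /sub. Qed.

Lemma indegS (S S' : {set W * W}) a : S \subset S' -> (indeg S a <= indeg S' a)%N.
Proof. by move=> /subsetP sub; apply/subset_leq_card/subsetP=> b; rewrite !inE => /sub. Qed.

Lemma outdeg_lt (S S' : {set W * W}) a :
  (outdeg S a < outdeg S' a)%N -> exists b, (a, b) \in S' :\: S.
Proof.
move=> lt; suff /set0Pn[b] : [set b | (a, b) \in S'] :\: [set b | (a, b) \in S] != set0.
  by rewrite !inE => bb; exists b; rewrite !inE.
by rewrite setD_eq0; apply: contraTN lt => /subset_leq_card; rewrite leqNgt.
Qed.

Lemma indeg_lt (S S' : {set W * W}) p :
  S \subset S' -> p \in S' :\: S -> (indeg S p.2 < indeg S' p.2)%N.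
Proof.
case: p => a b /subsetP sub; rewrite inE => /andP[abS abS'].
apply/proper_card/properP; split; first by apply/subsetP=> c; rewrite !inE => /sub.
by exists a; rewrite inE.
Qed.

Lemma esumU1 (S : {set W * W}) p u : p \notin S ->
  esum (enum (p |: S)) u = u p.1 p.2 + esum (enum S) u.
Proof. by move=> pS; rewrite /esum !big_enum big_setU1. Qed.

Lemma sum_outdeg (S : {set W * W}) : (\sum_a outdeg S a = #|S|)%N.
Proof.
rewrite (eq_bigr (fun a => \sum_(b | (a, b) \in S) 1)%N) => [|a _]; last by rewrite sum1dep_card.
rewrite pair_big_dep sum1dep_card.
by apply: eq_card => -[a b]; rewrite !inE.
Qed.

Lemma sum_indeg (S : {set W * W}) : (\sum_b indeg S b = #|S|)%N.
Proof.
rewrite (eq_bigr (fun b => \sum_(a | (a, b) \in S) 1)%N) => [|a _]; last by rewrite sum1dep_card.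
rewrite (exchange_big_dep predT) //= pair_big_dep sum1dep_card.
by apply: eq_card => -[a b]; rewrite !inE.
Qed.

Lemma cardD1_subset (S S' : {set W * W}) p : S \subset S' -> p \in S' :\: S ->
  [/\ p |: S \subset S', p \notin S & #|S' :\: S| = (#|S' :\: (p |: S)|).+1].
Proof.
move=> sub pS; have := pS; rewrite inE => /andP[pS1 pS'].
split=> //; first by rewrite subUset sub1set pS'.
by rewrite (cardsD1 p) pS add1n setUC setDDl.
Qed.

Variables E12 E23 E31 : {set W * W}.
Hypothesis dE12 : forall a, (outdeg E12 a <= d)%N /\ (indeg E12 a <= d)%N.
Hypothesis dE23 : forall a, (outdeg E23 a <= d)%N /\ (indeg E23 a <= d)%N.
Hypothesis dE31 : forall a, (outdeg E31 a <= d)%N /\ (indeg E31 a <= d)%N.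
Hypothesis bal1 : forall a, outdeg E12 a = indeg E31 a.
Hypothesis bal2 : forall a, outdeg E23 a = indeg E12 a.
Hypothesis bal3 : forall a, outdeg E31 a = indeg E23 a.
Hypothesis num1 : (7 * B + 4 * (t + r) + 2 * d + 2 * 2 + 2 * r + 87 < #|G|)%N.
Hypothesis num2 : (7 * B + 6 * d + 6 * 2 + 6 * r + 6 < #|G|)%N.
Hypothesis num3 : (6 * (t + r) + 119 < h)%N.
Hypothesis numK : (K < B.+1 * t.+1)%N.
Variable hub : W.

Lemma subtract_triangle_in L (F12 F23 F31 : {set W * W}) X12 X23 X31 x y z :
  covers L F12 F23 F31 X12 X23 X31 ->
  F12 \subset E12 -> F23 \subset E23 -> F31 \subset E31 ->
  (size X12 <= 2)%N -> (size X23 <= 2)%N -> (size X31 <= 2)%N ->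
  ((x, y) \notin F12) || ((x, y) \in X12) ->
  ((y, z) \notin F23) || ((y, z) \in X23) ->
  ((z, x) \notin F31) || ((z, x) \in X31) ->
  (#|lost L| <= K)%N ->
  exists2 L', forall u v w, \sum_(s <- L') weight u v w s + weight u v w (x, y, z)
    = \sum_(s <- L) weight u v w s & (#|lost L'| <= #|lost L| + 45)%N.
Proof.
move=> cov s12 s23 s31 l12 l23 l31 h12 h23 h31 lt.
apply: (subtract_triangle cov) => //; last exact: leq_ltn_trans numK.
- by move=> a; apply: leq_trans (outdegS a s12) _; case: (dE12 a).
- by move=> a; apply: leq_trans (indegS a s12) _; case: (dE12 a).
- by move=> a; apply: leq_trans (indegS a s23) _; case: (dE23 a).
- by move=> a; apply: leq_trans (outdegS a s31) _; case: (dE31 a).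
- by move=> a; apply: leq_trans (indegS a s31) _; case: (dE31 a).
Qed.

Definition closed_walk (F12 F23 F31 : {set W * W}) (L : seq tri) :=
  [/\ F12 \subset E12, F23 \subset E23 & F31 \subset E31] /\
  [/\ forall a, outdeg F12 a = indeg F31 a, forall a, outdeg F23 a = indeg F12 a,
     forall a, outdeg F31 a = indeg F23 a & covers L F12 F23 F31 [::] [::] [::]].

(* The edges removed so far form closed walks and one walk from [x0] to [z0],
   which [x0 hub z0] closes. *)
Definition open_walk x0 z0 (F12 F23 F31 : {set W * W}) (L : seq tri) :=
  [/\ F12 \subset E12, F23 \subset E23 & F31 \subset E31] /\
  [/\ forall a, outdeg F12 a = (indeg F31 a + (a == x0))%N,
      forall a, outdeg F23 a = indeg F12 a,
      forall a, indeg F23 a = (outdeg F31 a + (a == z0))%N &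
      covers L F12 F23 F31 [:: (x0, hub)] [:: (hub, z0)] [::]].

Lemma lost_cons s L : (#|lost (s :: L)| <= #|lost L|)%N.
Proof.
apply/subset_leq_card/subsetP=> p; rewrite !inE negb_or.
by move=> /and3P[-> _ ->].
Qed.

Lemma esum1 p u : esum [:: p] u = u p.1 p.2.
Proof. by rewrite /esum big_seq1. Qed.
Lemma esum2 p p' u : esum [:: p; p'] u = u p.1 p.2 + u p'.1 p'.2.
Proof. by rewrite /esum !big_cons big_nil addr0. Qed.
Lemma esumnil u : esum [::] u = 0.
Proof. by rewrite /esum big_nil. Qed.

(** An edge from the second part to the third is always consumed together with one from the first to
    the second, so the other two kinds of edges measure what remains. Each of them costs one
    subtraction, that is, at most 45 losses. *)
Lemma finish_walk n :
  (forall F12 F23 F31 L, closed_walk F12 F23 F31 L ->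
    (#|E12 :\: F12| + #|E31 :\: F31| <= n)%N -> (#|lost L| + 45 * n <= K)%N ->
    exists L', covers L' E12 E23 E31 [::] [::] [::]) /\
  (forall x0 z0 F12 F23 F31 L, open_walk x0 z0 F12 F23 F31 L ->
    (#|E12 :\: F12| + #|E31 :\: F31| <= n)%N -> (#|lost L| + 45 * n <= K)%N ->
    exists L', covers L' E12 E23 E31 [::] [::] [::]).
Proof.
elim/ltn_ind: n => n IH; split.
  move=> F12 F23 F31 L [[s12 s23 s31] [b1 b2 b3 cov]] len lK.
  (* Once [E12] is used up, balance forces the other two families to be used up as well. *)
  have [e12|] := eqVneq (E12 :\: F12) set0.
    have eF12 : F12 = E12 by apply/eqP; rewrite eqEsubset s12 -setD_eq0 e12 eqxx.
    have eF23 : F23 = E23.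
      apply/eqP; rewrite eqEcard s23 -!sum_outdeg.
      by apply: leq_sum => a _; rewrite b2 bal2 eF12.
    have eF31 : F31 = E31.
      apply/eqP; rewrite eqEcard s31 -!sum_outdeg.
      by apply: leq_sum => a _; rewrite b3 bal3 eF23.
    by exists L; rewrite -eF12 -eF23 -eF31.
  case/set0Pn=> -[x y] xyD.
  have [z yzD] : exists z, (y, z) \in E23 :\: F23.
    apply: outdeg_lt; rewrite b2 bal2; exact: (indeg_lt s12 xyD).
  have [s12' xyF c12] := cardD1_subset s12 xyD.
  have [s23' yzF c23] := cardD1_subset s23 yzD.
  have n0 : (0 < n)%N by move: len; rewrite c12 addSn; case: (n).
  have lK' : (#|lost L| <= K)%N by apply: leq_trans lK; rewrite leq_addr.
  (* The added triangle covers [z x] once more, so [x y z] can be subtracted even if [z x] has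
     already been omitted. The net effect is to trade [x y], [y z] for [x hub], [hub z]. *)
  have cov1 : covers ((x, hub, z) :: L) F12 F23 F31 [:: (x, hub)] [:: (hub, z)] [:: (z, x)].
    move=> u v w; rewrite big_cons !esum1 /= {1}/weight /=.
    by have := cov u v w; rewrite !esumnil; lra.
  have [|||||||L' eL' lL'] := subtract_triangle_in (x := x) (y := y) (z := z) cov1 s12 s23 s31
      _ _ _ _ _ _ _ => //.
  - by rewrite xyF.
  - by rewrite yzF.
  - by rewrite inE eqxx orbT.
  - by apply: leq_trans lK'; apply: lost_cons.
  apply: (proj2 (IH n.-1 _) x z ((x, y) |: F12) ((y, z) |: F23) F31 L'); first by rewrite ltn_predL.
  - split; split=> // [a|a|a|u v w].
    + by rewrite outdegU1 // b1.
    + by rewrite outdegU1 // indegU1 // b2.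
    + by rewrite indegU1 // b3.
    + have := cov1 u v w; rewrite -eL' !esum1 !esumU1 //= esumnil /weight /=; lra.
  - by move: len; rewrite c12 addSn; case: (n).
  - apply: leq_trans lK; rewrite -{2}(prednK n0) mulnS addnA leq_add2r.
    by apply: leq_trans lL' _; rewrite leq_add2r; apply: lost_cons.
move=> x0 z0 F12 F23 F31 L [[s12 s23 s31] [b1 b2 b3 cov]] len lK.
have [x zxD] : exists x, (z0, x) \in E31 :\: F31.
  by apply: outdeg_lt; rewrite bal3; apply: leq_trans (indegS z0 s23); rewrite b3 eqxx addn1.
have [s31' zxF c31] := cardD1_subset s31 zxD.
have n0 : (0 < n)%N by move: len; rewrite c31 addnS; case: (n).
have lK' : (#|lost L| <= K)%N by apply: leq_trans lK; rewrite leq_addr.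
(* When the walk returns to its start, subtracting [x0 hub z0] uses up both surplus edges and the
   missing edge [z0 x0]. *)
have [exx0|xx0] := eqVneq x x0.
  subst x0.
  have [||||||L' eL' lL'] := subtract_triangle_in (x := x) (y := hub) (z := z0) cov s12 s23 s31
      _ _ _ _ _ _ lK' => //.
  - by rewrite inE eqxx orbT.
  - by rewrite inE eqxx orbT.
  - by rewrite zxF.
  apply: (proj1 (IH n.-1 _) F12 F23 ((z0, x) |: F31) L'); first by rewrite ltn_predL.
  - split; split=> // [a|a|u v w].
    + by rewrite indegU1 // b1.
    + by rewrite outdegU1 // b3.
    + have := cov u v w; rewrite -eL' !esum1 !esumU1 //= !esumnil /weight /=; lra.
  - by move: len; rewrite c31 addnS; case: (n).
  - apply: leq_trans lK; rewrite -{2}(prednK n0) mulnS addnA leq_add2r.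
    exact: lL'.
have [y xyD] : exists y, (x, y) \in E12 :\: F12.
  by apply: outdeg_lt; rewrite bal1 b1 (negPf xx0) addn0; apply: (indeg_lt s31 zxD).
have [z yzD] : exists z, (y, z) \in E23 :\: F23.
  by apply: outdeg_lt; rewrite b2 bal2; exact: (indeg_lt s12 xyD).
have [s12' xyF c12] := cardD1_subset s12 xyD.
have [s23' yzF c23] := cardD1_subset s23 yzD.
have n1 : (1 < n)%N by move: len; rewrite c31 c12 addSn addnS; case: (n) => [|[]].
(* To prolong the walk, [x hub z0] is subtracted for the edge [z0 x], then [x y z] for [x y] and
   [y z]; the surplus is then [x0 hub], [hub z]. This is where two surplus edges of one kind
   occur. *)
have cov1 : covers ((x, hub, z) :: L) F12 F23 F31 [:: (x0, hub); (x, hub)]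
    [:: (hub, z0); (hub, z)] [:: (z, x)].
  move=> u v w; rewrite big_cons !esum2 esum1 /= {1}/weight /=.
  by have := cov u v w; rewrite !esum1 !esumnil /=; lra.
have [|||||||L2 eL2 lL2] := subtract_triangle_in (x := x) (y := hub) (z := z0) cov1 s12 s23 s31
    _ _ _ _ _ _ _ => //.
- by rewrite !inE eqxx !orbT.
- by rewrite !inE eqxx !orbT.
- by rewrite zxF.
- by apply: leq_trans lK'; apply: lost_cons.
have cov2 : covers L2 F12 F23 ((z0, x) |: F31) [:: (x0, hub)] [:: (hub, z)] [:: (z, x)].
  move=> u v w; have := cov1 u v w.
  by rewrite -eL2 !esum1 !esum2 !esumU1 //= /weight /=; lra.
have lL2' : (#|lost L2| <= #|lost L| + 45)%N.
  by apply: leq_trans lL2 _; rewrite leq_add2r; apply: lost_cons.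
have [|||||||L3 eL3 lL3] := subtract_triangle_in (x := x) (y := y) (z := z) cov2 s12 s23 s31'
    _ _ _ _ _ _ _ => //.
- by rewrite xyF.
- by rewrite yzF.
- by rewrite !inE eqxx !orbT.
- by apply: leq_trans lL2' (leq_trans _ lK); rewrite leq_add2l leq_pmulr.
apply: (proj2 (IH n.-2 _) x0 z ((x, y) |: F12) ((y, z) |: F23) ((z0, x) |: F31) L3).
- by move: n1; case: (n) => [|[]].
- split; split=> // [a|a|a|u v w].
  + by rewrite outdegU1 // indegU1 // b1 addnAC.
  + by rewrite outdegU1 // indegU1 // b2.
  + by rewrite indegU1 // outdegU1 // b3 addnAC.
  + have := cov2 u v w; rewrite -eL3 !esum1 !esumU1 //= !esumnil /weight /=; lra.
- by move: len; rewrite c31 c12 addSn addnS; case: (n) => [|[]].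
- apply: leq_trans lK; move: n1 lL3 lL2'; case: (n) => [|[|k]] //= _.
  by move: #|lost L3| #|lost L2| #|lost L| => c b a h1 h2; clear -h1 h2; lia.
Qed.
End Walk.

(** * A Latin square with many octahedra *)

Section LatinSum.
Variables (U : finType) (k : U -> U -> U).
Hypothesis kl : forall x, injective (k x).
Hypothesis kr : forall y, injective (k^~ y).

Lemma latin_total (u v w : U -> U -> int) :
  \sum_x \sum_y (u x y + v y (k x y) + w (k x y) x) = \sum_x \sum_y (u x y + v x y + w x y).
Proof.
transitivity (\sum_x \sum_y u x y + \sum_x \sum_y v y (k x y) + \sum_x \sum_y w (k x y) x).
  by rewrite -!big_split; apply: eq_bigr => x _; rewrite -!big_split.
have -> : \sum_x \sum_y v y (k x y) = \sum_x \sum_y v x y.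
  by rewrite exchange_big; apply: eq_bigr => y _; rewrite [RHS](reindex_inj (kr (y := y))).
have -> : \sum_x \sum_y w (k x y) x = \sum_x \sum_y w x y.
  by rewrite [RHS]exchange_big; apply: eq_bigr => x _; rewrite [RHS](reindex_inj (kl (x := x))).
by rewrite -!big_split; apply: eq_bigr => x _; rewrite -!big_split.
Qed.

End LatinSum.

Lemma cyclic_square n : exists k : 'I_n -> 'I_n -> 'I_n,
  (forall x, injective (k x)) /\ (forall y, injective (k^~ y)).
Proof.
case: n => [|n]; first by exists (fun x _ => x); split=> -[].
by exists (fun x y => x + y); split=> [x|y]; [apply: addrI|apply: addIr].
Qed.

Section Square.
Variable A : finComNzRingType.
Hypothesis dbl_inj : injective (fun x : A => x + x).
Notation cls := (bool * bool)%type.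
Notation G := (cls * A)%type.

Definition addc (a b : cls) : cls := (a.1 (+) b.1, a.2 (+) b.2).

(* Sign patterns: the product with classes [a], [b] solves [x + y + z = 0] if [a
   = 0], [z = x + y] if [b = 0] or [b = a], and [y = x + z] otherwise.  They
   make the four equations on the vertices of an octahedron dependent, which is
   what [octahedronE] says. *)
Definition latin3 (x y : G) : G := (addc x.1 y.1,
  if x.1 == (false, false) then - x.2 - y.2
  else if (y.1 == (false, false)) || (y.1 == x.1) then x.2 + y.2 else y.2 - x.2).
Definition latin2 (z x : G) : G := let b := addc z.1 x.1 in (b,
  if x.1 == (false, false) then - x.2 - z.2
  else if (b == (false, false)) || (b == x.1) then z.2 - x.2 else x.2 + z.2).
Definition latin1 (y z : G) : G := let a := addc y.1 z.1 in (a,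
  if a == (false, false) then - y.2 - z.2
  else if (y.1 == (false, false)) || (y.1 == a) then z.2 - y.2 else y.2 - z.2).
(** Depends on classes only: for given [x] and [y], three of the four classes of [z] are off, and
    [octahedronE] covers all of them. *)
Definition off (x y z : G) := addc x.1 y.1 != z.1.

Ltac by_classes := repeat (case=> [[[] []] ?]); rewrite /latin1 /latin2 /latin3 /off /addc //= => *; congr (_, _); ring.

Lemma latinK13 x y : latin1 y (latin3 x y) = x. Proof. move: x y; by_classes. Qed.
Lemma latinK23 x y : latin2 (latin3 x y) x = y. Proof. move: x y; by_classes. Qed.
Lemma latinK31 y z : latin3 (latin1 y z) y = z. Proof. move: y z; by_classes. Qed.
Lemma latinK21 y z : latin2 z (latin1 y z) = y. Proof. move: y z; by_classes. Qed.
Lemma latinK32 z x : latin3 x (latin2 z x) = z. Proof. move: x z; by_classes. Qed.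
Lemma latinK12 z x : latin1 (latin2 z x) z = x. Proof. move: x z; by_classes. Qed.
Lemma off_on x y : off x y (latin3 x y) = false. Proof. by rewrite /off eqxx. Qed.
Lemma octahedronE x y z : off x y z -> latin3 (latin1 y z) (latin2 z x) = latin3 x y.
Proof. move: x y z; by_classes. Qed.

Lemma card_class (c : cls) : #|[set x : G | x.1 == c]| = #|A|.
Proof.
rewrite -[RHS]cardsT -(card_imset _ (_ : injective (fun a : A => (c, a)))); last by move=> a b [].
apply: eq_card => -[c' a]; rewrite !inE /=; apply/eqP/imsetP => [->|[b _ [-> _]] //].
by exists a.
Qed.

(** Each octahedron condition excludes one class of the hub, so two conditions leave at least two of
    the four classes. *)
Lemma card_off (S : {set G}) (c c' : cls) :
  (forall x, x.1 != c -> x.1 != c' -> x \in S) -> (2 * #|A| <= #|S|)%N.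
Proof.
move=> sub; have cG : #|{: G}| = (4 * #|A|)%N by rewrite !card_prod card_bool.
have : ~: S \subset [set x | x.1 == c] :|: [set x | x.1 == c'].
  apply/subsetP=> x; rewrite !inE; apply: contraR; rewrite negb_or => /andP[].
  exact: sub.
move=> /subset_leq_card /leq_trans/(_ (card_setUle _ _)); rewrite !card_class.
by have := cardsC S; rewrite cG; lia.
Qed.

Lemma off_card1 y z y' z' : (2 * #|A| <= #|[set x | off x y z && off x y' z']|)%N.
Proof.
apply: (@card_off _ (addc y.1 z.1) (addc y'.1 z'.1)) => x; rewrite inE /off.
by case: x y z y' z' => [[[] []] ?] [[[] []] ?] [[[] []] ?] [[[] []] ?] [[[] []] ?].
Qed.

Lemma off_card3 x y x' y' : (2 * #|A| <= #|[set z | off x y z && off x' y' z]|)%N.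
Proof.
apply: (@card_off _ (addc x.1 y.1) (addc x'.1 y'.1)) => z; rewrite inE /off.
by move=> h1 h2; rewrite eq_sym h1 eq_sym h2.
Qed.

Variables (r : nat) (c : 'I_r -> A).
Hypothesis c_inj : injective c.

(* Multiplication by a generator of the field with four elements is a complete
   mapping of the class group. *)
Definition rotc (a : cls) : cls := (a.1 (+) a.2, a.1).
Definition theta j (x : G) : G :=
  (rotc x.1, if x.1 == (false, false) then x.2 + c j else - (x.2 + c j)).
Definition zeta j (x : G) : G := latin3 x (theta j x).

Lemma theta_inj j : injective (theta j).
Proof.
move=> [[[] []] a] [[[] []] b] //= []; try by move/oppr_inj/addIr->.
by move/addIr->.
Qed.

(** The sign in [theta] matches the cases of [latin3], so that the second coordinate has the same
    form in all classes. The doubling that appears is why [A] is taken of odd order. *)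
Lemma zetaE j x : zeta j x = (addc x.1 (rotc x.1), - (x.2 + x.2) - c j).
Proof. by move: x => [[[] []] a]; rewrite /zeta /latin3 /theta //=; congr (_, _); ring. Qed.

Lemma zeta_inj j : injective (zeta j).
Proof.
move=> x y; rewrite !zetaE; case: x y => [[[] []] a] [[[] []] b] //= [];
  by move/addIr/oppr_inj/dbl_inj->.
Qed.

Lemma theta_j j j' x : theta j x = theta j' x -> j = j'.
Proof.
case: x => -[[] []] a //= [].
1-3: by move/oppr_inj/addrI/c_inj.
by move/addrI/c_inj.
Qed.

Definition transversals : {set G * G} := [set p | [exists j, p.2 == theta j p.1]].

Lemma card_transversals1 x : (#|[set y | (x, y) \in transversals]| <= r)%N.
Proof.
apply: leq_trans (_ : #|[set theta j x | j : 'I_r]| <= _)%N.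
  apply/subset_leq_card/subsetP=> y; rewrite !inE /= => /existsP[j /eqP->].
  exact: imset_f.
by apply: leq_trans (leq_imset_card _ _) _; rewrite cardT size_enum_ord.
Qed.

Lemma card_transversals2 y : (#|[set z | (latin1 y z, y) \in transversals]| <= r)%N.
Proof.
apply: leq_trans (_ : #|[set latin3 (invF (@theta_inj j) y) y | j : 'I_r]| <= _)%N.
  apply/subset_leq_card/subsetP=> z; rewrite !inE /= => /existsP[j /eqP e].
  apply/imsetP; exists j => //; rewrite [X in latin3 (invF _ X)]e invF_f.
  by rewrite latinK31.
by apply: leq_trans (leq_imset_card _ _) _; rewrite cardT size_enum_ord.
Qed.

Lemma card_transversals3 z : (#|[set x | (x, latin2 z x) \in transversals]| <= r)%N.
Proof.
apply: leq_trans (_ : #|[set invF (@zeta_inj j) z | j : 'I_r]| <= _)%N.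
  apply/subset_leq_card/subsetP=> x; rewrite !inE /= => /existsP[j /eqP e].
  apply/imsetP; exists j => //; apply: (@zeta_inj j); rewrite f_invF.
  by rewrite /zeta -e latinK32.
by apply: leq_trans (leq_imset_card _ _) _; rewrite cardT size_enum_ord.
Qed.

Notation W := (G + 'I_r)%type.
Variable k : 'I_r -> 'I_r -> 'I_r.
Hypothesis kl : forall x, injective (k x).
Hypothesis kr : forall y, injective (k^~ y).

(** The classical prolongation of a Latin square along [r] disjoint transversals: the triangle of
    each transversal cell gives way to three triangles through a new vertex, placed in each part in
    turn, and the new vertices carry a square of their own. *)
Definition prolongation : seq (W * W * W) :=
  [seq (inl p.1, inl p.2, inl (latin3 p.1 p.2)) : W * W * W | p <- enum (~: transversals)]
  ++ [seq (inl p.2, inl (theta p.1 p.2), inr p.1) : W * W * W | p <- enum {: 'I_r * G}]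
  ++ [seq (inl p.2, inr p.1, inl (zeta p.1 p.2)) : W * W * W | p <- enum {: 'I_r * G}]
  ++ [seq (inr p.1, inl (theta p.1 p.2), inl (zeta p.1 p.2)) : W * W * W | p <- enum {: 'I_r * G}]
  ++ [seq (inr p.1, inr p.2, inr (k p.1 p.2)) : W * W * W | p <- enum {: 'I_r * 'I_r}].

Lemma latin3_injl x : injective (latin3 x).
Proof. by move=> y y' e; rewrite -(latinK23 x y) e latinK23. Qed.
Lemma latin3_injr y : injective (latin3^~ y).
Proof. by move=> x x' e; rewrite -(latinK13 x y) e latinK13. Qed.

Lemma sum_transversals (F : G -> G -> int) :
  \sum_(p in transversals) F p.1 p.2 = \sum_j \sum_x F x (theta j x).
Proof.
rewrite pair_big /=; pose g (q : 'I_r * G) := (q.2, theta q.1 q.2).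
have g_inj : injective g.
  move=> [j x] [j' x'] e; have ex : x = x' := congr1 fst e.
  by have := congr1 snd e; rewrite /= -ex => /theta_j ->.
have -> : transversals = g @: [set: 'I_r * G].
  apply/setP=> -[x y]; rewrite !inE /=; apply/existsP/imsetP => [[j /eqP->]|[[j x'] _ [-> ->]]].
    by exists (j, x); rewrite ?inE.
  by exists j.
rewrite big_imset /=; last by move=> x y _ _ /g_inj.
by apply: eq_bigl => q; rewrite inE.
Qed.

Lemma prolongation_weight (u v w : W -> W -> int) :
  \sum_(s <- prolongation) weight u v w s = total u v w.
Proof.
rewrite /prolongation !big_cat /= !big_map !big_enum /=.
rewrite -(pair_big predT predT (fun j x => weight u v w (inl x, inl (theta j x), inr j))) /=.
rewrite -(pair_big predT predT (fun j x => weight u v w (inl x, inr j, inl (zeta j x)))) /=.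
rewrite -(pair_big predT predT (fun j x => weight u v w (inr j, inl (theta j x), inl (zeta j x)))) /=.
rewrite -(pair_big predT predT (fun i j => weight u v w (inr i, inr j, inr (k i j)))) /=.
pose m x y := weight u v w (inl x, inl y, inl (latin3 x y)).
have eG : \sum_(p in ~: transversals) m p.1 p.2 = \sum_x \sum_y m x y - \sum_j \sum_x m x (theta j x).
  rewrite -sum_transversals pair_big /= [X in _ = X - _](bigID (mem transversals)) /= addrAC subrr add0r.
  by apply: eq_bigl => p; rewrite inE.
rewrite {}eG.
have eM : \sum_x \sum_y m x y = \sum_x \sum_y (u (inl x) (inl y) + v (inl x) (inl y) + w (inl x) (inl y)).
  exact: (latin_total latin3_injl latin3_injr (fun x y => u (inl x) (inl y)) (fun x y => v (inl x) (inl y)) (fun x y => w (inl x) (inl y))).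
have eI := latin_total kl kr (fun x y => u (inr x) (inr y)) (fun x y => v (inr x) (inr y)) (fun x y => w (inr x) (inr y)).
have eT : total u v w = \sum_x \sum_y (u (inl x) (inl y) + v (inl x) (inl y) + w (inl x) (inl y))
   + \sum_j \sum_x (u (inl x) (inr j) + v (inl x) (inr j) + w (inl x) (inr j))
   + \sum_j \sum_x (u (inr j) (inl x) + v (inr j) (inl x) + w (inr j) (inl x))
   + \sum_x \sum_y (u (inr x) (inr y) + v (inr x) (inr y) + w (inr x) (inr y)).
  rewrite /total big_sumType /=.
  under eq_bigr => x _ do rewrite big_sumType /=.
  under [X in _ + X = _]eq_bigr => x _ do rewrite big_sumType /=.
  by rewrite !big_split /= [\sum_(i : G) \sum_(j : 'I_r) _]exchange_big /= !addrA.
have eJ : \sum_j \sum_x weight u v w (inl x, inl (theta j x), inr j)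
   + \sum_j \sum_x weight u v w (inl x, inr j, inl (zeta j x))
   + \sum_j \sum_x weight u v w (inr j, inl (theta j x), inl (zeta j x))
   - \sum_j \sum_x m x (theta j x)
  = \sum_j \sum_x (u (inl x) (inr j) + v (inl x) (inr j) + w (inl x) (inr j))
   + \sum_j \sum_x (u (inr j) (inl x) + v (inr j) (inl x) + w (inr j) (inl x)).
  rewrite -!big_split -sumrB; apply: eq_bigr => j _ /=.
  rewrite -!big_split -sumrB /=.
  transitivity (\sum_x (u (inl x) (inr j) + w (inr j) (inl x)) + \sum_x (v (inl (theta j x)) (inr j) + u (inr j) (inl (theta j x)))
     + \sum_x (w (inl (zeta j x)) (inr j) + v (inr j) (inl (zeta j x)))).
    rewrite -!big_split /=; apply: eq_bigr => x _; rewrite /m /weight /= -/(zeta j x); ring.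
  have -> : \sum_x (v (inl (theta j x)) (inr j) + u (inr j) (inl (theta j x)))
      = \sum_x (v (inl x) (inr j) + u (inr j) (inl x)).
    by rewrite [RHS](reindex_inj (@theta_inj j)).
  have -> : \sum_x (w (inl (zeta j x)) (inr j) + v (inr j) (inl (zeta j x)))
      = \sum_x (w (inl x) (inr j) + v (inr j) (inl x)).
    by rewrite [RHS](reindex_inj (@zeta_inj j)).
  by rewrite -!big_split /=; apply: eq_bigr => x _; ring.
rewrite eT eM -eI.
move: eJ; rewrite /weight /=; lra.
Qed.

Lemma prolongation_lost :
  lost inl latin3 transversals prolongation = set0.
Proof.
apply/setP=> p; rewrite !inE; apply/negbTE; rewrite negb_and negbK.
apply/orP; have [pT|pT] := boolP (p \in transversals); [left|right].
  by rewrite inE in pT.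
rewrite negbK mem_cat; apply/orP; left; apply/mapP; exists p => //.
by rewrite mem_enum inE.
Qed.
End Square.

(** * From coverings to decompositions *)

Section Decomposition.
Variables (T W : finType) (e : rel T) (i1 i2 i3 : W -> T).
Hypothesis e_sym : symmetric e.
Hypotheses (inj1 : injective i1) (inj2 : injective i2) (inj3 : injective i3).
Hypothesis n12 : forall x y, i1 x != i2 y.
Hypothesis n23 : forall x y, i2 x != i3 y.
Hypothesis n13 : forall x y, i1 x != i3 y.
Hypothesis parts : forall v, [\/ exists x, v = i1 x, exists x, v = i2 x | exists x, v = i3 x].
Hypothesis e11 : forall x y, ~~ e (i1 x) (i1 y).
Hypothesis e22 : forall x y, ~~ e (i2 x) (i2 y).
Hypothesis e33 : forall x y, ~~ e (i3 x) (i3 y).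

Lemma triangle_edges3 (a b c : T) : a != b -> b != c -> a != c ->
  triangle_edges [set a; b; c] = [set [set a; b]; [set b; c]; [set a; c]].
Proof.
move=> ab bc ac; apply/setP=> B; rewrite !inE; apply/andP/idP.
  case=> /subsetP sub /cards2P[x [y [xy eB]]]; move: sub; rewrite {}eB => sub.
  have := sub x; have := sub y; rewrite !inE !eqxx !orbT => /(_ isT) + /(_ isT).
  move=> /orP[/orP[]|] /eqP ey /orP[/orP[]|] /eqP ex; subst x y; rewrite ?eqxx // in xy *;
    by rewrite ?eqxx ?orbT // setUC eqxx ?orbT.
case/orP=> [/orP[]|] /eqP->; rewrite cards2 ?ab ?bc ?ac; split=> //;
  by apply/subsetP=> v; rewrite !inE => /orP[] /eqP->; rewrite eqxx ?orbT.
Qed.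

Lemma set2_inj (a b c d : T) : [set a; b] = [set c; d] ->
  (a = c /\ b = d) \/ (a = d /\ b = c).
Proof.
move=> eq; have ac : a \in [set c; d] by rewrite -eq set21.
have bc : b \in [set c; d] by rewrite -eq set22.
have ca : c \in [set a; b] by rewrite eq set21.
have da : d \in [set a; b] by rewrite eq set22.
move: ac bc ca da; rewrite !inE.
by move=> /orP[] /eqP ? /orP[] /eqP ? /orP[] /eqP ? /orP[] /eqP ?; subst; auto.
Qed.

Variables E12 E23 E31 : {set W * W}.
Hypothesis E12P : forall x y, ((x, y) \in E12) = ~~ e (i1 x) (i2 y).
Hypothesis E23P : forall x y, ((x, y) \in E23) = ~~ e (i2 x) (i3 y).
Hypothesis E31P : forall x y, ((x, y) \in E31) = ~~ e (i3 x) (i1 y).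
Variable L : seq (W * W * W).
Hypothesis cov : covers L E12 E23 E31 [::] [::] [::].

Let tset (s : W * W * W) : {set T} := [set i1 s.1.1; i2 s.1.2; i3 s.2].
Let tedges s : triangle_edges (tset s) = [set [set i1 s.1.1; i2 s.1.2]; [set i2 s.1.2; i3 s.2]; [set i1 s.1.1; i3 s.2]].
Proof. by rewrite triangle_edges3. Qed.

Let mem_count (p : pred (W * W * W)) s : s \in L -> p s -> (0 < count p L)%N.
Proof. by move=> sL ps; rewrite -has_count; apply/hasP; exists s. Qed.

Let uniq_count (p : pred (W * W * W)) s s' : (count p L <= 1)%N ->
  s \in L -> s' \in L -> p s -> p s' -> s = s'.
Proof.
move=> c1 sL s'L ps ps'; apply/eqP; apply: contraLR c1 => ss'; rewrite -ltnNge -size_filter.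
apply: (@uniq_leq_size _ [:: s; s']); first by rewrite /= inE ss'.
by move=> v; rewrite !inE mem_filter => /orP[] /eqP->; rewrite ?ps ?ps'.
Qed.

Let edge12 s : s \in L -> e (i1 s.1.1) (i2 s.1.2).
Proof.
move=> sL; have := cov12 cov s.1.1 s.1.2; rewrite E12P.
have := mem_count (p := fun s' => (s'.1.1 == s.1.1) && (s'.1.2 == s.1.2)) sL.
by rewrite !eqxx => /(_ isT); case: (count _ L) => // k _; case: (e _ _); rewrite //= addn1.
Qed.
Let edge23 s : s \in L -> e (i2 s.1.2) (i3 s.2).
Proof.
move=> sL; have := cov23 cov s.1.2 s.2; rewrite E23P.
have := mem_count (p := fun s' => (s'.1.2 == s.1.2) && (s'.2 == s.2)) sL.
by rewrite !eqxx => /(_ isT); case: (count _ L) => // k _; case: (e _ _); rewrite //= addn1.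
Qed.
Let edge31 s : s \in L -> e (i3 s.2) (i1 s.1.1).
Proof.
move=> sL; have := cov31 cov s.2 s.1.1; rewrite E31P.
have := mem_count (p := fun s' => (s'.2 == s.2) && (s'.1.1 == s.1.1)) sL.
by rewrite !eqxx => /(_ isT); case: (count _ L) => // k _; case: (e _ _); rewrite //= addn1.
Qed.

Lemma edge_eq a b : e a b -> [set a; b] \in edges e.
Proof.
by move=> eab; rewrite inE; apply/existsP; exists a; apply/existsP; exists b; rewrite eab eqxx.
Qed.

Let count_le1 (b : bool) (k : nat) : (k + b = 1 + 0 -> k <= 1)%N.
Proof. by case: b; case: k => [|[]]. Qed.

(** A common edge joins the same two parts in both triangles, and [cov] allows it only one entry of
    [L]. *)
Let triangle_eq s s' (B : {set T}) : s \in L -> s' \in L ->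
  B \in triangle_edges (tset s) -> B \in triangle_edges (tset s') -> s = s'.
Proof.
move=> sL s'L; rewrite !tedges !inE.
have m12 x y : (i2 y == i1 x) = false by rewrite eq_sym; apply/negbTE.
have m23 x y : (i3 y == i2 x) = false by rewrite eq_sym; apply/negbTE.
have m13 x y : (i3 y == i1 x) = false by rewrite eq_sym; apply/negbTE.
have same12 : s.1.1 = s'.1.1 -> s.1.2 = s'.1.2 -> s = s'.
  move=> e1 e2; apply: (uniq_count (count_le1 (cov12 cov s.1.1 s.1.2)) sL s'L).
    by rewrite !eqxx.
  by rewrite e1 e2 !eqxx.
have same23 : s.1.2 = s'.1.2 -> s.2 = s'.2 -> s = s'.
  move=> e1 e2; apply: (uniq_count (count_le1 (cov23 cov s.1.2 s.2)) sL s'L).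
    by rewrite !eqxx.
  by rewrite e1 e2 !eqxx.
have same31 : s.2 = s'.2 -> s.1.1 = s'.1.1 -> s = s'.
  move=> e1 e2; apply: (uniq_count (count_le1 (cov31 cov s.2 s.1.1)) sL s'L).
    by rewrite !eqxx.
  by rewrite e1 e2 !eqxx.
have neqs : [/\ forall x y, i1 x <> i2 y, forall x y, i2 y <> i1 x &
  [/\ forall x y, i2 x <> i3 y, forall x y, i3 y <> i2 x,
      forall x y, i1 x <> i3 y & forall x y, i3 y <> i1 x]].
  by split; last split; move=> x y /eqP; rewrite ?m12 ?m23 ?m13 // ?(negPf (n12 _ _)) ?(negPf (n23 _ _)) ?(negPf (n13 _ _)).
case: neqs => h1 h2 [h3 h4 h5 h6].
by move=> /orP[/orP[]|] /eqP-> /orP[/orP[]|] /eqP/set2_inj[] [a b];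
  solve [by case: (h1 _ _ a) | by case: (h2 _ _ a) | by case: (h3 _ _ a) | by case: (h4 _ _ a)
   | by case: (h5 _ _ a) | by case: (h6 _ _ a)
   | by case: (h1 _ _ b) | by case: (h2 _ _ b) | by case: (h3 _ _ b) | by case: (h4 _ _ b)
   | by case: (h5 _ _ b) | by case: (h6 _ _ b)
   | apply: same12; [exact: inj1 a | exact: inj2 b]
   | apply: same23; [exact: inj2 a | exact: inj3 b]
   | apply: same31; [exact: inj3 b | exact: inj1 a]].
Qed.

Lemma covers_decomposition : exists D : {set {set T}}, triangle_decomposition e D.
Proof.
exists [set A in map tset L]; split.
  move=> A; rewrite inE => /mapP[s sL ->]; apply/andP; split.
    rewrite /tset setUC cardsU1 cards2 !inE negb_or n12.
    by rewrite ![i3 _ == _]eq_sym n13 n23.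
  have e12 := edge12 sL; have e23 := edge23 sL; have e31 := edge31 sL.
  apply/forallP=> x; apply/implyP=> xA; apply/forallP=> y; apply/implyP=> yA; apply/implyP.
  move: xA yA; rewrite !inE => /orP[/orP[]|] /eqP-> /orP[/orP[]|] /eqP->; rewrite ?eqxx //.
  - by rewrite e_sym.
  - by rewrite e_sym.
  - by rewrite e_sym.
have inD s B : s \in L -> B \in triangle_edges (tset s) ->
    exists2 X, X \in [set triangle_edges A | A in [set A in map tset L]] & B \in X.
  move=> sL Bs; exists (triangle_edges (tset s)) => //.
  by apply: imset_f; rewrite inE map_f.
apply/and3P; split.
- apply/eqP/setP=> B; apply/bigcupP/idP.
    move=> [X /imsetP[A + ->]]; rewrite inE => /mapP[s sL ->].
    rewrite tedges => /setUP[/setUP[]|] /set1P->.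
    + exact: (edge_eq (edge12 sL)).
    + exact: (edge_eq (edge23 sL)).
    + by apply: edge_eq; rewrite e_sym edge31.
  have h12 x y : e (i1 x) (i2 y) -> exists2 X, X \in [set triangle_edges A | A in [set A in map tset L]] & [set i1 x; i2 y] \in X.
    move=> exy; have [|z sL] := @exists_third _ _ _ _ _ _ _ _ cov x y; first by rewrite E12P exy.
    by apply: (inD _ _ sL); rewrite tedges !inE eqxx.
  have h23 x y : e (i2 x) (i3 y) -> exists2 X, X \in [set triangle_edges A | A in [set A in map tset L]] & [set i2 x; i3 y] \in X.
    move=> exy; have [|z sL] := @exists_first _ _ _ _ _ _ _ _ cov x y; first by rewrite E23P exy.
    by apply: (inD _ _ sL); rewrite tedges !inE eqxx orbT.
  have h13 x y : e (i1 x) (i3 y) -> exists2 X, X \in [set triangle_edges A | A in [set A in map tset L]] & [set i1 x; i3 y] \in X.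
    move=> exy; have [|z sL] := @exists_second _ _ _ _ _ _ _ _ cov y x; first by rewrite E31P e_sym exy.
    by apply: (inD _ _ sL); rewrite tedges !inE eqxx !orbT.
  rewrite inE => /existsP[a /existsP[b /andP[eab /eqP->]]].
  case: (parts a) eab => -[x ->]; case: (parts b) => -[y ->] eab.
  + by rewrite (negPf (e11 _ _)) in eab.
  + exact: h12.
  + exact: h13.
  + by rewrite setUC; apply: h12; rewrite e_sym.
  + by rewrite (negPf (e22 _ _)) in eab.
  + exact: h23.
  + by rewrite setUC; apply: h13; rewrite e_sym.
  + by rewrite setUC; apply: h23; rewrite e_sym.
  + by rewrite (negPf (e33 _ _)) in eab.
- apply/trivIsetP=> X Y /imsetP[A + ->] /imsetP[A' + ->]; rewrite !inE.
  move=> /mapP[s sL ->] /mapP[s' s'L ->]; apply: contraR.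
  rewrite -setI_eq0 => /set0Pn[B]; rewrite inE => /andP[Bs Bs'].
  by rewrite (triangle_eq sL s'L Bs Bs').
- apply/imsetP=> -[A]; rewrite inE => /mapP[s sL ->] /setP/(_ [set i1 s.1.1; i2 s.1.2]).
  by rewrite tedges !inE eqxx.
Qed.
End Decomposition.

(** * Numerical parameters and coverings of given order *)

Lemma Zp_dbl_inj m : (1 < m)%N -> odd m -> injective (fun x : 'Z_m => x + x).
Proof.
move=> m1 om x y /=; rewrite -![_ + _]mulr2n -[x *+ 2]mulr_natr -[y *+ 2]mulr_natr.
by apply: mulIr; rewrite unitZpE // coprimen2.
Qed.

Lemma Zp_nat_inj m r : (1 < m)%N -> (r <= m)%N -> injective (fun j : 'I_r => (j%:R : 'Z_m)).
Proof.
move=> m1 rm i j /(congr1 val) /=; rewrite !val_Zp_nat //.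
by rewrite !modn_small ?(leq_trans (ltn_ord _) rm) // => /val_inj.
Qed.

Definition balanced_sets (W : finType) (E12 E23 E31 : {set W * W}) (d : nat) :=
  [/\ forall a, [/\ outdeg E12 a <= d, outdeg E23 a <= d & outdeg E31 a <= d]%N,
      forall a, outdeg E12 a = indeg E31 a,
      forall a, outdeg E23 a = indeg E12 a &
      forall a, outdeg E31 a = indeg E23 a].

(** With nothing missing any Latin square will do. This case is separate because n may then be too
    small for the choices of octahedra. *)
Lemma covers_cyclic n (E12 E23 E31 : {set 'I_n * 'I_n}) d :
  balanced_sets E12 E23 E31 d -> #|E12| = 0%N ->
  exists L, covers L E12 E23 E31 [::] [::] [::].
Proof.
move=> [_ b1 b2 b3] E0; have [k [kl kr]] := cyclic_square n.
have E120 : E12 = set0 by apply: cards0_eq.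
have E230 : E23 = set0.
  by apply: cards0_eq; rewrite -sum_outdeg (eq_bigr (indeg E12)) // sum_indeg.
have E310 : E31 = set0.
  by apply: cards0_eq; rewrite -sum_outdeg (eq_bigr (indeg E23)) // E230 sum_indeg cards0.
exists [seq (p.1, p.2, k p.1 p.2) | p <- enum {: 'I_n * 'I_n}] => u v w.
rewrite E120 E230 E310 /esum !enum_set0 !big_nil !addr0 big_map big_enum /=.
by rewrite -(pair_big predT predT (fun x y => weight u v w (x, y, k x y))) /= /total -(latin_total kl kr).
Qed.

Lemma ltn_sqr_of (a b : nat) : (a * a < b ^ 2)%N -> (a < b)%N.
Proof. by rewrite mulnn ltn_exp2r. Qed.

(** Here [s] stands for n - 132d. The least t with 45M <= 2t^2 satisfies 2(t-1)^2 < 45M, hence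
    (60(t-1))^2 < 81000M <= 288^2 M < s^2. *)
Lemma threshold_bounds s M : (0 < M)%N -> (288 * 288 * M < s ^ 2)%N ->
  exists t, [/\ 45 * M <= 2 * t ^ 2, 288 < s & 60 * t < s + 60]%N.
Proof.
move=> M0 Ms.
have s288 : (288 < s)%N.
  by apply: ltn_sqr_of; apply: leq_ltn_trans Ms; rewrite leq_pmulr.
have exP : exists t, (45 * M <= 2 * t ^ 2)%N by exists (45 * M)%N; nia.
case: (ex_minnP exP) => t tP t_min.
exists t; split=> //; case: t tP t_min => [|t] tP t_min; first by rewrite addn_gt0 orbT.
rewrite mulnS addnC ltn_add2r; apply: ltn_sqr_of.
have : ~~ (45 * M <= 2 * t ^ 2)%N by apply/negP => /t_min; rewrite ltnn.
rewrite -ltnNge mulnACA -[(t * t)%N]/(t ^ 2)%N -mulnA.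
by move: (t ^ 2)%N (s ^ 2)%N Ms => u v; clear; lia.
Qed.

Lemma covers_large n d M : (0 < M)%N -> (0 < d)%N ->
  (288 * 288 * M < (n - 132 * d) ^ 2)%N ->
  exists2 W : finType, #|W| = n & forall E12 E23 E31 : {set W * W},
    balanced_sets E12 E23 E31 d -> #|E12| = M ->
    exists L, covers L E12 E23 E31 [::] [::] [::].
Proof.
move=> M0 d0 Mn; have [t [tM n288 tn]] := threshold_bounds M0 Mn.
(* Dividing n - 4 by 8 gives n = 4m + r with m odd and r at most 7. *)
pose q := ((n - 4) %/ 8)%N; pose m := q.*2.+1; pose r := ((n - 4) %% 8)%N.
have r7 : (r <= 7)%N by rewrite -ltnS ltn_mod.
have en : n = (4 * m + r)%N.
  have e8 : (n - 4 = q * 8 + r)%N := divn_eq (n - 4) 8.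
  move: e8 n288; rewrite /m -muln2; move: (q) (r) => q' r'; clear; lia.
have m7 : (7 < m)%N.
  by move: en r7 n288; move: (m) (r) => m' r' ->; clear; lia.
have m1 : (1 < m)%N by apply: ltn_trans m7.
have rm : (r <= m)%N by apply: leq_trans r7 (ltnW m7).
have om : odd m by rewrite /= odd_double.
pose A : finComNzRingType := 'Z_m.
have cA : #|A| = m by rewrite card_ord Zp_cast.
pose c (j : 'I_r) : A := j%:R.
have c_inj : injective c := Zp_nat_inj m1 rm.
have [k [kl kr]] := cyclic_square r.
pose G : finType := ((bool * bool) * A)%type.
have cG : #|G| = (4 * m)%N by rewrite !card_prod card_bool cA.
pose W : finType := (G + 'I_r)%type.
have cW : #|W| = (#|G| + r)%N by rewrite card_sum card_ord.
exists W; first by rewrite cW cG -en.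
move=> E12 E23 E31 [dE b1 b2 b3] cE.
have /card_gt0P[hub _] : (0 < #|W|)%N.
  by rewrite cW cG -en; apply: leq_trans (leq_subr (132 * d) n); apply: leq_trans n288.
have cE31 : #|E31| = M.
  by rewrite -sum_indeg -cE -sum_outdeg; apply: eq_bigr => a _; rewrite b1.
have bs : forall a, [/\ outdeg E12 a <= d /\ indeg E12 a <= d, outdeg E23 a <= d /\ indeg E23 a <= d
    & outdeg E31 a <= d /\ indeg E31 a <= d]%N.
  by move=> a; case: (dE a) => *; rewrite -b1 -b2 -b3.
(* The terms in t amount to at most 32t against n, while 60t < s + 60. The additive constants are
   absorbed by s > 288 and by the slack 132d, with d > 0. The last bound is 90M <= 4t^2. *)
have [n1 n2 n3 nK] : [/\ (7 * (4 * t) + 4 * (t + r) + 2 * d + 2 * 2 + 2 * r + 87 < #|G|)%N,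
   (7 * (4 * t) + 6 * d + 6 * 2 + 6 * r + 6 < #|G|)%N,
   (6 * (t + r) + 119 < 2 * #|A|)%N & (45 * (2 * M) < (4 * t).+1 * t.+1)%N].
  rewrite cG cA; move: en r7 n288 tn tM d0; move: (m) (r) => m' r' ->.
  by clear => r7 n288 tn tM d0; split; nia.
have [fin _] := @finish_walk W G inl r (@inl_inj _ _) (eq_leq cW) (@latin1 A) (@latin2 A) (@latin3 A) (@off A)
  (@latinK13 A) (@latinK23 A) (@latinK31 A) (@latinK21 A) (@latinK32 A) (@latinK12 A) (@off_on A) (@octahedronE A)
  (2 * #|A|) t (4 * t) d (45 * (2 * M)) (@off_card1 A) (@off_card3 A) (@transversals A r c)
  (@card_transversals1 A r c) (@card_transversals2 A r c) (@card_transversals3 A (Zp_dbl_inj m1 om) r c) E12 E23 E31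
  (fun a => let: And3 x _ _ := bs a in x) (fun a => let: And3 _ x _ := bs a in x)
  (fun a => let: And3 _ _ x := bs a in x) b1 b2 b3 n1 n2 n3 nK hub (2 * M).
apply: (fin set0 set0 set0 (prolongation c k)).
- split; first by rewrite !sub0set.
  have z (a : W) : outdeg set0 a = 0%N by apply: eq_card0 => b; rewrite !inE.
  have z' (a : W) : indeg set0 a = 0%N by apply: eq_card0 => b; rewrite !inE.
  split=> [a|a|a|u v w]; rewrite ?z ?z' //.
  rewrite (prolongation_weight (Zp_dbl_inj m1 om) c_inj kl kr) /esum !enum_set0 !big_nil.
  by rewrite !addr0.
- by rewrite !setD0 cE cE31 addnn mul2n.
- by rewrite prolongation_lost cards0.
Qed.

Lemma enumerate_set (T W : finType) (A : {set T}) : #|W| = #|A| ->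
  exists2 f : W -> T, injective f & f @: setT = A.
Proof.
move=> WA; exists (fun x => enum_val (cast_ord WA (enum_rank x))).
  by move=> x y /enum_val_inj/cast_ord_inj/enum_rank_inj.
apply/setP=> v; apply/imsetP/idP => [[x _ ->]|vA]; first exact: enum_valP.
exists (enum_val (cast_ord (esym WA) (enum_rank_in vA v))) => //.
by rewrite enum_valK cast_ordKV enum_rankK_in.
Qed.

Lemma Z3_cases (i : 'Z_3) : [\/ i = 0, i = 1 | i = -1].
Proof.
by case: i => [[|[|[|i]]] hi] //; [apply: Or31|apply: Or32|apply: Or33]; apply: val_inj.
Qed.

(** * Coordinates on the three parts of the graph *)

Section Setup.
Variables (T : finType) (e : rel T) (V : 'Z_3 -> {set T}) (n d : nat).
Hypothesis e_simple : simple_graph e.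
Hypothesis V_tripartition : tripartition e V.
Hypothesis card_parts : forall i, #|V i| = n.
Hypothesis deg_eq : forall i v, v \in V i -> deg_plus e V i v = deg_minus e V i v.
Hypothesis deg_ge : forall i v, v \in V i -> (n <= deg_plus e V i v + d)%N.

Definition missing : {set T * T} :=
  [set p | [&& p.1 \in V 0, p.2 \in V 1 & ~~ e p.1 p.2]].

(** [W] is arbitrary because the vertex type of the square is chosen only after [M] has been
    estimated; [missing] counts the same edges without reference to coordinates. *)
Lemma coordinates (W : finType) : #|W| = n ->
  exists i1 i2 i3 : W -> T, exists E12 E23 E31 : {set W * W},
  [/\ balanced_sets E12 E23 E31 d, #|E12| = #|missing|,
      (#|edges e| + 3 * #|missing| <= 3 * n ^ 2)%N &
      forall L, covers L E12 E23 E31 [::] [::] [::] ->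
        exists D : {set {set T}}, triangle_decomposition e D].
Proof.
case: e_simple => e_sym _; case: V_tripartition => V_part V_indep cW.
have [i1 inj1 im1] := enumerate_set (etrans cW (esym (card_parts 0))).
have [i2 inj2 im2] := enumerate_set (etrans cW (esym (card_parts 1))).
have [i3 inj3 im3] := enumerate_set (etrans cW (esym (card_parts (-1)))).
have v1 x : i1 x \in V 0 by rewrite -im1 imset_f.
have v2 x : i2 x \in V 1 by rewrite -im2 imset_f.
have v3 x : i3 x \in V (-1) by rewrite -im3 imset_f.
have V_uniq v i j : v \in V i -> v \in V j -> i = j.
  by have [k [_ ku]] := V_part v; move=> /ku<- /ku<-.
have parts v : [\/ exists x, v = i1 x, exists x, v = i2 x | exists x, v = i3 x].
  have [k [vk _]] := V_part v; case: (Z3_cases k) vk => ->.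
  - by rewrite -im1 => /imsetP[x _ ->]; apply: Or31; exists x.
  - by rewrite -im2 => /imsetP[x _ ->]; apply: Or32; exists x.
  - by rewrite -im3 => /imsetP[x _ ->]; apply: Or33; exists x.
have n12 x y : i1 x != i2 y.
  by apply/eqP=> eq; have := v2 y; rewrite -eq => /V_uniq/(_ (v1 x)).
have n23 x y : i2 x != i3 y.
  by apply/eqP=> eq; have := v3 y; rewrite -eq => /V_uniq/(_ (v2 x)).
have n13 x y : i1 x != i3 y.
  by apply/eqP=> eq; have := v3 y; rewrite -eq => /V_uniq/(_ (v1 x)).
pose E12 := [set p | ~~ e (i1 p.1) (i2 p.2)].
pose E23 := [set p | ~~ e (i2 p.1) (i3 p.2)].
pose E31 := [set p | ~~ e (i3 p.1) (i1 p.2)].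
have compl (f : W -> T) A v : injective f -> f @: setT = A ->
    (#|[set y | ~~ e v (f y)]| + #|[set w in A | e v w]| = n)%N.
  move=> fi <-; rewrite -cW addnC -(cardC [pred y | e v (f y)]); congr (_ + _)%N.
    rewrite -(card_imset _ fi); apply: eq_card => w; rewrite !inE.
    apply/andP/imsetP => [[/imsetP[y _ ->] ey]|[y ey ->]]; first by exists y.
    by split; rewrite ?imset_f //; move: ey; rewrite inE.
  by apply: eq_card => y; rewrite !inE.
have o12 x : (outdeg E12 x + deg_plus e V 0%R (i1 x) = n)%N.
  rewrite -(compl i2 _ (i1 x) inj2 im2) /deg_plus add0r; congr (_ + _)%N.
  by apply: eq_card => y; rewrite !inE.
have o23 x : (outdeg E23 x + deg_plus e V 1%R (i2 x) = n)%N.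
  rewrite -(compl i3 _ (i2 x) inj3 im3) /deg_plus (_ : 1 + 1 = -1 :> 'Z_3); last exact: val_inj.
  by congr (_ + _)%N; apply: eq_card => y; rewrite !inE.
have o31 x : (outdeg E31 x + deg_plus e V (-1)%R (i3 x) = n)%N.
  rewrite -(compl i1 _ (i3 x) inj1 im1) /deg_plus addNr.
  by congr (_ + _)%N; apply: eq_card => y; rewrite !inE.
have i31 x : (indeg E31 x + deg_minus e V 0%R (i1 x) = n)%N.
  rewrite -(compl i3 _ (i1 x) inj3 im3) /deg_minus add0r; congr (_ + _)%N.
  by apply: eq_card => y; rewrite !inE e_sym.
have i12 x : (indeg E12 x + deg_minus e V 1%R (i2 x) = n)%N.
  rewrite -(compl i1 _ (i2 x) inj1 im1) /deg_minus subrr; congr (_ + _)%N.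
  by apply: eq_card => y; rewrite !inE e_sym.
have i23 x : (indeg E23 x + deg_minus e V (-1)%R (i3 x) = n)%N.
  rewrite -(compl i2 _ (i3 x) inj2 im2) /deg_minus (_ : -1 - 1 = 1 :> 'Z_3); last exact: val_inj.
  by congr (_ + _)%N; apply: eq_card => y; rewrite !inE e_sym.
have b1 a : outdeg E12 a = indeg E31 a.
  by apply/eqP; rewrite -(eqn_add2r (deg_plus e V 0%R (i1 a))) o12 deg_eq // i31.
have b2 a : outdeg E23 a = indeg E12 a.
  by apply/eqP; rewrite -(eqn_add2r (deg_plus e V 1%R (i2 a))) o23 deg_eq // i12.
have b3 a : outdeg E31 a = indeg E23 a.
  by apply/eqP; rewrite -(eqn_add2r (deg_plus e V (-1)%R (i3 a))) o31 deg_eq // i23.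
have cE23 : #|E23| = #|E12| by rewrite -sum_outdeg -sum_indeg; apply: eq_bigr.
have cE31 : #|E31| = #|E12|.
  by rewrite -cE23 -sum_outdeg -[RHS]sum_indeg; apply: eq_bigr.
have cE12 : #|E12| = #|missing|.
  rewrite -(card_imset _ (_ : injective (fun p => (i1 p.1, i2 p.2)))); last first.
    by move=> [x y] [x' y'] [/inj1-> /inj2->].
  apply: eq_card => -[v w]; apply/imsetP/idP => [[[x y] + [-> ->]]|].
    by rewrite !inE /= v1 v2.
  rewrite !inE /= -im1 -im2 => /and3P[/imsetP[x _ ->] /imsetP[y _ ->] exy].
  by exists (x, y); rewrite ?inE.
exists i1, i2, i3, E12, E23, E31; split=> //.
- split=> // a; split.
  + by have := deg_ge (v1 a); rewrite -(o12 a) addnC leq_add2l.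
  + by have := deg_ge (v2 a); rewrite -(o23 a) addnC leq_add2l.
  + by have := deg_ge (v3 a); rewrite -(o31 a) addnC leq_add2l.
(* By balance the three families of missing edges have equal size, so each pair of parts spans n^2 -
   M edges. *)
- pose g (i j : W -> T) (p : W * W) := [set i p.1; j p.2].
  have sub : edges e \subset (g i1 i2 @: ~: E12) :|: (g i2 i3 @: ~: E23) :|: (g i3 i1 @: ~: E31).
    apply/subsetP=> B; rewrite inE => /existsP[a /existsP[b /andP[eab /eqP->]]].
    rewrite !inE; case: (parts a) eab => -[x ->]; case: (parts b) => -[y ->] eab.
    + by rewrite (negPf (V_indep _ _ _ (v1 x) (v1 y))) in eab.
    + by rewrite (imset_f (g i1 i2) (x := (x, y))) // !inE negbK.
    + by rewrite setUC (imset_f (g i3 i1) (x := (y, x))) ?orbT // !inE negbK e_sym.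
    + by rewrite setUC (imset_f (g i1 i2) (x := (y, x))) ?orbT // !inE negbK e_sym.
    + by rewrite (negPf (V_indep _ _ _ (v2 x) (v2 y))) in eab.
    + by rewrite (imset_f (g i2 i3) (x := (x, y))) ?orbT // !inE negbK.
    + by rewrite (imset_f (g i3 i1) (x := (x, y))) ?orbT // !inE negbK.
    + by rewrite setUC (imset_f (g i2 i3) (x := (y, x))) ?orbT // !inE negbK e_sym.
    + by rewrite (negPf (V_indep _ _ _ (v3 x) (v3 y))) in eab.
  have := leq_trans (subset_leq_card sub) (leq_trans (card_setUle _ _) (leq_add (card_setUle _ _) (leqnn _))).
  have c1 := leq_imset_card (g i1 i2) (~: E12); have c2 := leq_imset_card (g i2 i3) (~: E23).
  have c3 := leq_imset_card (g i3 i1) (~: E31).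
  have s1 := cardsC E12; have s2 := cardsC E23; have s3 := cardsC E31.
  rewrite card_prod cW mulnn in s1 s2 s3; rewrite -cE12.
  move: c1 c2 c3 s1 s2 s3; rewrite cE23 cE31.
  move: #|edges e| #|g i1 i2 @: ~: E12| #|g i2 i3 @: ~: E23| #|g i3 i1 @: ~: E31| #|~: E12| #|~: E23| #|~: E31| #|E12| (n ^ 2)%N.
  by clear; lia.
- move=> L cov; apply: (covers_decomposition e_sym inj1 inj2 inj3 n12 n23 n13 parts _ _ _ _ _ _ cov).
  + by move=> x y; apply: V_indep.
  + by move=> x y; apply: V_indep.
  + by move=> x y; apply: V_indep.
  + by move=> x y; rewrite inE.
  + by move=> x y; rewrite inE.
  + by move=> x y; rewrite inE.
Qed.
End Setup.

Theorem theorem5p1p2 (R : realType) (eps delta : R)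
    (eps_ge0 : 0 <= eps) (delta_ge0 : 0 <= delta)
    (eps_lt : eps < 1 / 132%:R)
    (delta_lt : delta < (1 - 132%:R * eps) ^+ 2 / 83272%:R)
    (T : finType) (e : rel T) (V : 'Z_3 -> {set T}) (n : nat)
    (e_simple : simple_graph e)
    (V_tripartition : tripartition e V)
    (card_parts : forall i, #|V i| = n)
    (deg_cond : forall i v, v \in V i ->
      deg_plus e V i v = deg_minus e V i v /\
      (1 - eps) * n%:R <= (deg_minus e V i v)%:R)
    (edge_cond : (1 - delta) * (3%:R * n%:R ^+ 2) < #|edges e|%:R) :
  exists D : {set {set T}}, triangle_decomposition e D.
Proof.
have en0 : 0 <= eps * n%:R by rewrite mulr_ge0.
(* Degree deficits are integers, so the bound eps n can be rounded down. *)
pose d := Num.trunc (eps * n%:R).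
have /andP[d_le d_gt] := truncn_itv en0; rewrite -/d in d_le d_gt.
have deg_eq i v : v \in V i -> deg_plus e V i v = deg_minus e V i v by case/deg_cond.
have deg_ge i v : v \in V i -> (n <= deg_plus e V i v + d)%N.
  move=> vi; have [-> ge] := deg_cond i v vi.
  rewrite -ltnS -addnS -(ltr_nat R) natrD; lra.
have setup := coordinates e_simple V_tripartition card_parts deg_eq deg_ge.
(* These coordinates serve to estimate [M] and to settle the case M = 0; otherwise the square
   provides new ones. *)
have [i1 [i2 [i3 [E12 [E23 [E31 [bal cE edges_le dec]]]]]]] := setup _ (card_ord n).
set M := #|missing e V| in cE edges_le setup.
have [M0|M0] := posnP M.
  by have [|L covL] := covers_cyclic bal; [rewrite cE|apply: dec covL].
have d0 : (0 < d)%N.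
  rewrite lt0n; apply/eqP => d00; move: M0; rewrite -cE -sum_outdeg big1 // => a _.
  by case: bal => + _ _ _ => /(_ a) [+ _ _]; rewrite d00 leqn0 => /eqP.
have n0 : (0 < n)%N.
  by move: M0; rewrite -cE => /card_gt0P[[x _] _]; apply: leq_ltn_trans (ltn_ord x).
have N0 : 0 < n%:R :> R by rewrite ltr0n.
have edges_leR : #|edges e|%:R + 3%:R * M%:R <= 3%:R * n%:R ^+ 2 :> R.
  by rewrite -natrM -natrD -natrX -natrM ler_nat.
have M_lt : M%:R < delta * n%:R ^+ 2 by lra.
have eps_lt' : 0 < 1 - 132%:R * eps by lra.
have y0 : 0 < (1 - 132%:R * eps) * n%:R by rewrite mulr_gt0.
have y_le : (1 - 132%:R * eps) * n%:R <= n%:R - 132%:R * d%:R :> R by lra.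
have y2 : ((1 - 132%:R * eps) * n%:R) ^+ 2 <= (n%:R - 132%:R * d%:R) ^+ 2.
  by rewrite ler_sqr ?nnegrE ?(ltW y0) ?(le_trans (ltW y0)).
have d_le_n : (132 * d <= n)%N.
  by rewrite -(ler_nat R) natrM; lra.
have MR : 83272%:R * M%:R < (n%:R - 132%:R * d%:R) ^+ 2 :> R.
  apply: lt_le_trans y2; rewrite exprMn.
  apply: lt_trans (_ : 83272%:R * delta * n%:R ^+ 2 < _).
    by rewrite -mulrA ltr_pM2l // ltr0n.
  by rewrite ltr_pM2r ?exprn_gt0 // -ltr_pdivlMl ?ltr0n // mulrC.
(* 288 is the largest integer whose square, 82944, does not exceed 83272. *)
have Mn : (288 * 288 * M < (n - 132 * d) ^ 2)%N.
  rewrite -(ltr_nat R) natrX natrB // !natrM; apply: le_lt_trans MR.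
  by rewrite ler_wpM2r //; lra.
have [W cW coverW] := covers_large M0 d0 Mn.
have [j1 [j2 [j3 [F12 [F23 [F31 [balW cF _ decW]]]]]]] := setup _ cW.
by have [L covL] := coverW _ _ _ balW cF; apply: decW covL.
Qed.
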